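(* Let $\Lambda_0<\Lambda_1$ and $\epsilon$ be positive real numbers with $\Lambda_0+\epsilon\le\Lambda_1$, and let $j\ge 0$ be an integer. Then there are an integer $r_1=r_1(\Lambda_0,\Lambda_1,j,\epsilon)\ge j+1$ and a real $\theta_1=\theta_1(\Lambda_0,\Lambda_1,j,\epsilon)>0$ (depending only on $\Lambda_0,\Lambda_1,j,\epsilon$) with the following properties. Let $\{\mathcal{M}_n\}_{n\in N}$ be a $(\Lambda_0,\Lambda_1)$-bounded matrix model that has an order $r$ expansion $$\mathbb{E}_{M\in\mathcal{M}_n}[\mathrm{Trace}(M^k)]=c_0(k)+c_1(k)/n+\cdots+c_{r-1}(k)/n^{r-1}+O(c_r(k))/n^r$$ for some $r\ge r_1$. For $0\le i\le r$ let $L_i$ denote the set of larger bases of $c_0(k),\ldots,c_{i-1}(k)$ (with respect to $\Lambda_0$). If $L_j=\emptyset$, then $$\mathbb{E}\mathrm{out}_{\mathcal{M}_n}[B_{\Lambda_0+\epsilon}(0)]=O(n^{-j}).$$ In more detail, for any positive $\theta\le\theta_1$ we have $$\mathbb{E}\mathrm{out}_{\mathcal{M}_n}\bigl[B_{\Lambda_0+\epsilon}(0)\cup B_{n^{-\theta}}(L_{j+1})\bigr]=o(n^{-j}).$$ Furthermore, for each $\ell\in L_{j+1}$ with $|\ell|\ge\Lambda_0+2\epsilon/3$ we have $$\mathbb{E}\mathrm{in}_{\mathcal{M}_n}\bigl[B_{n^{-\theta}}(\ell)\bigr]=C_\ell n^{-j}+o(n^{-j})$$ for some real $C_\ell\ge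 0$. Furthermore, if $q_{\ell,j}=q_{\ell,j}(k)$ are the polynomials in $k$ such that $$p_j(k)=\sum_{\ell\in L_{j+1}}q_{\ell,j}(k)\ell^k$$ is the polyexponential part of $c_j(k)$ (with respect to $\Lambda_0$), then if $|\ell|\ge\Lambda_0+2\epsilon/3$ we have that $$q_{\ell,j}(k)=C_\ell$$ is a constant function of $k$.
   Context: Notation. $\mathbb{N}$ is the set of positive integers. For real $\rho\ge 0$ and $z\in\mathbb{C}$, $B_\rho(z)=\{x\in\mathbb{C}: |x-z|\le\rho\}$; for $L\subset\mathbb{C}$, $B_\rho(L)=\bigcup_{\ell\in L}B_\rho(\ell)$. Real intervals are viewed as subsets of $\mathbb{C}$. All probability spaces are finite with every atom of positive probability. For a probability space $\mathcal{M}$ of square matrices and $R\subset\mathbb{C}$, $\mathbb{E}\mathrm{in}_{\mathcal{M}}[R]$ (respectively $\mathbb{E}\mathrm{out}_{\mathcal{M}}[R]$) is the expected number of eigenvalues of $M\in\mathcal{M}$, counted with multiplicity, that lie in $R$ (respectively not in $R$). Polyexponentials. A function $Q:\mathbb{N}\to\mathbb{C}$ is polyexponential if $Q(k)=\sum_{\ell\in L}p_\ell(k)\ell^k$ with $L\subset\mathbb{C}$ finite and $p_\ell$ polynomials, where for $\ell=0$ the expression $p_\ell(k)\ell^k$ means any function vanishing for $k$ sufficiently large. The representation is unique if $L$ is minimal (only nonzero terms are kept); the minimal $L$ is the set of bases of $Q$. A function $f:\mathbb{N}\to\mathbb{C}$ is of growth $\rho$ ($\rho\in\mathbb{R}$)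 if for every $\epsilon>0$, $|f(k)|<(\rho+\epsilon)^k$ for $k$ sufficiently large. An approximate polyexponential with error growth $\rho$ is a function $Q=f+g$ with $f$ polyexponential and $g$ of growth $\rho$; $f,g$ are uniquely determined if one insists that all bases of $f$ have absolute value greater than $\rho$; this $f$ is the polyexponential part of $Q$ with respect to $\rho$, and its bases are the larger bases of $Q$ with respect to $\rho$. Matrix models. Let $0<\Lambda_0<\Lambda_1$. A $(\Lambda_0,\Lambda_1)$-bounded matrix model is a collection of finite probability spaces $\{\mathcal{M}_n\}_{n\in N}$, with $N\subset\mathbb{N}$ infinite, where the atoms of $\mathcal{M}_n$ are $n\times n$ real-valued matrices whose eigenvalues lie in $B_{\Lambda_0}(0)\cup[-\Lambda_1,\Lambda_1]\subset\mathbb{C}$. For an integer $r\ge 0$ the model has an order $r$ expansion if, for some $K:\mathbb{N}\to\mathbb{N}$ with $K(n)/\log n\to\infty$ as $n\to\infty$, $$\mathbb{E}_{M\in\mathcal{M}_n}[\mathrm{Trace}(M^k)]=c_0(k)+c_1(k)/n+\cdots+c_{r-1}(k)/n^{r-1}+O(c_r(k))/n^r$$ for all $n\in N$ and integers $k$ with $1\le k\le K(n)$, where (1) $c_r$ is of growth $\Lambda_1$; (2) the constant in $O(c_r(k))$ is independent of $k$ and $n$; (3) for $0\le i<r$, $c_i$ is an approximate polyexponential with error growth $\Lambda_0$ whose larger bases (with respect to $\Lambda_0$) lie in $[-\Lambda_1,\Lambda_1]$. The ''set of larger bases of $c_0,\ldots,c_{i-1}$'' means the union of the sets of larger bases of these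 functions. Asymptotics in $n$ are as $n\to\infty$ with $n$ confined to $N$. *)

(* Defs.v *)
From HB Require Import structures.
From mathcomp Require Import all_boot all_order all_algebra finmap.
From mathcomp Require Import complex.
From mathcomp Require Import all_classical all_reals all_analysis.

Set Implicit Arguments.
Unset Strict Implicit.
Unset Printing Implicit Defensive.

Import Order.TTheory GRing.Theory Num.Theory.
Import numFieldNormedType.Exports.

Local Open Scope classical_set_scope.
Local Open Scope ring_scope.
Local Open Scope complex_scope.

(* Functions on the positive integers are encoded as functions on [nat] whose
   value at [0] is never inspected. *)

Section Regions.
Variable R : realType.
Implicit Types (rho a b : R) (z : R[i]) (L : set R[i]).

(* [normc : R[i] -> R] is the modulus as an element of [R]. *)
Definition cdisk rho z : set R[i] := [set x | Normc.normc (x - z) <= rho].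

Definition cthick rho L : set R[i] := \bigcup_(l in L) cdisk rho l.

Definition cinterval a b : set R[i] := [set x%:C | x in `[a, b]].

End Regions.

Section Polyexponentials.
Variable R : realType.
Implicit Types (Q f g z : nat -> R[i]) (L : {fset R[i]}).
Implicit Types (p : R[i] -> {poly R[i]}) (rho : R).

(* [z] stands for the term of base 0, an arbitrary function that vanishes for
   large [k]; it is present only if [0 \in L]. *)
Definition polyexp_repr L p z Q : Prop :=
  [/\ \forall k \near \oo, z k = 0,
      0 \notin L -> forall k, (0 < k)%N -> z k = 0
    & forall k, (0 < k)%N ->
        Q k = \sum_(l <- L | l != 0) (p l).[k%:R] * l ^+ k + z k].

Definition polyexponential_over L Q : Prop := exists p z, polyexp_repr L p z Q.

Definition polyexponential Q : Prop := exists L, polyexponential_over L Q.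

Definition minimal_bases L Q : Prop :=
  polyexponential_over L Q /\
  forall L', (L' `<` L)%fset -> ~ polyexponential_over L' Q.

Definition bases Q : set R[i] :=
  [set l | exists2 L : {fset R[i]}, minimal_bases L Q & l \in L].

Definition of_growth rho f : Prop :=
  forall e : R, 0 < e -> \forall k \near \oo, Normc.normc (f k) < (rho + e) ^+ k.

Definition approx_polyexponential rho Q : Prop :=
  exists f g, [/\ polyexponential f, of_growth rho g
                & forall k, (0 < k)%N -> Q k = f k + g k].

(* [f] is determined by [rho] and [Q], up to its value at [0]. *)
Definition polyexp_part rho Q f : Prop :=
  [/\ polyexponential f,
      forall l, bases f l -> rho < Normc.normc l
    & exists2 g, of_growth rho g & forall k, (0 < k)%N -> Q k = f k + g k].

Definition larger_bases rho Q : set R[i] :=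
  [set l | exists2 f, polyexp_part rho Q f & bases f l].

(* The union of the sets of larger bases of [c 0, ..., c i.-1]. *)
Definition larger_bases_upto rho (c : nat -> nat -> R[i]) (i : nat) :
    set R[i] :=
  \bigcup_(m < i) larger_bases rho (c m).

End Polyexponentials.

Section MatrixModels.
Variable R : realType.

(* The eigenvalues of a real matrix in [R[i]], each repeated according to its
   algebraic multiplicity. *)
Definition spectrum n (M : 'M[R]_n) : seq R[i] :=
  sval (closed_field_poly_normal (char_poly (map_mx (real_complex R) M))).

Lemma prod_spectrum n (M : 'M[R]_n) :
  \prod_(z <- spectrum M) ('X - z%:P) = char_poly (map_mx (real_complex R) M).
Proof.
rewrite /spectrum; case: closed_field_poly_normal => s /=.
by rewrite (monicP (char_poly_monic _)) scale1r => <-.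
Qed.

Lemma mem_spectrum n (M : 'M[R]_n) z :
  (z \in spectrum M) = eigenvalue (map_mx (real_complex R) M) z.
Proof. by rewrite eigenvalue_root_char -prod_spectrum root_prod_XsubC. Qed.

Record matrix_probspace n := MatrixProbspace {
  atoms : {fset 'M[R]_n};
  prob : 'M[R]_n -> R;
  prob_gt0 : forall M, M \in atoms -> 0 < prob M;
  prob_sum1 : \sum_(M <- atoms) prob M = 1 }.

Definition expectation_mx n (P : matrix_probspace n) (X : 'M[R]_n -> R) : R :=
  \sum_(M <- atoms P) prob P M * X M.

Definition Ein n (P : matrix_probspace n) (A : set R[i]) : R :=
  expectation_mx P (fun M => (count (mem A) (spectrum M))%:R).

Definition Eout n (P : matrix_probspace n) (A : set R[i]) : R :=
  Ein P (~` A).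

(* [model_space n] belongs to the collection only if [n] is in [model_dims]. *)
Record matrix_model := MatrixModel {
  model_dims : set nat;
  model_dims_gt0 : forall n, model_dims n -> (0 < n)%N;
  model_dims_infinite : infinite_set model_dims;
  model_space : forall n, matrix_probspace n }.

Definition bounded_model (L0 L1 : R) (MM : matrix_model) : Prop :=
  forall n, model_dims MM n -> forall M, M \in atoms (model_space MM n) ->
  forall z, z \in spectrum M -> (cdisk L0 0 `|` cinterval (- L1) L1) z.

Definition model_oo (MM : matrix_model) : filter_on nat :=
  FilterType (within (model_dims MM) \oo) (within_filter _ _).

Definition has_expansion (L0 L1 : R) (MM : matrix_model) (r : nat)
    (c : nat -> nat -> R[i]) : Prop :=
  [/\ exists K : nat -> nat,
        [/\ forall n, (0 < n)%N -> (0 < K n)%N,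
            (K n)%:R / ln (n%:R : R) @[n --> model_oo MM] --> +oo
          & exists A : R, forall n, model_dims MM n ->
              forall k, (1 <= k <= K n)%N ->
              Normc.normc
                ((expectation_mx (model_space MM n) (fun M => \tr (M ^+ k)))%:C
                 - \sum_(i < r) c i k / n%:R ^+ i)
              <= A * Normc.normc (c r k) / n%:R ^+ r],
      of_growth L1 (c r)
    & forall i, (i < r)%N ->
        approx_polyexponential L0 (c i) /\
        larger_bases L0 (c i) `<=` cinterval (- L1) L1].

End MatrixModels.

(* Main.v *)
Require Import Defs.
From HB Require Import structures.
From mathcomp Require Import all_boot all_order all_algebra finmap.
From mathcomp Require Import complex.
From mathcomp Require Import all_classical all_reals all_analysis.
From mathcomp Require Import ring lra.

Set Implicit Arguments.
Unset Strict Implicit.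
Unset Printing Implicit Defensive.

Import Order.TTheory GRing.Theory Num.Theory.
Import numFieldNormedType.Exports.

Local Open Scope classical_set_scope.
Local Open Scope ring_scope.
Local Open Scope complex_scope.

(* Test the spectral measure against the polynomials [f ^ m * G], where [G] is a
   fixed real polynomial, [m] is of order [ln n], and [f] is a fixed polynomial
   approximating a step function: [0 <= f <= 1] on [[- L1, L1]], [f >= 1/2]
   where [|x| >= L0 + 2 eps / 3], and [f] is so small on the disk of radius
   [L0 + eps / 3] that [f ^ m] is negligible there, even after summing over the
   [n] eigenvalues. Since [f <= 1] at the bases of all the [c i], the terms with
   [i > j] contribute [n ^ (- j - 1)] up to a factor at most [2 ^ m], a small
   power of [n], however many bases they have; so only the polyexponential part
   of [c j] matters at order [n ^ - j]. A factor [(X - l) ^ d] of [G]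
   annihilates the term of base [l] when [d] exceeds the degree of its
   coefficient, so [G] isolates a single base:
   - if that coefficient had degree [d > 0], the test polynomials with extra
     factors [1], [(X - l) ^ d] and [(X - l) ^ (2 d)] would contradict
     [|s| <= t s ^ 2 + 1 / t] for a suitable [t];
   - comparing the extra factors [1] and [(X - l) ^ 2] gives the expected number
     of eigenvalues in the ball of radius [n ^ - theta] around [l];
   - a square factor [(X - l) ^ 2] at every relevant base bounds the expected
     number of outliers away from the bases. *)

(** * Pairing sequences with polynomials *)

(** Moments are available only up to [K n], which is known to outgrow [ln n] and nothing more; so
    the test polynomials have degree O(ln n), and [f ^ m] can gain or lose only a fixed power of
    [n]. All constants are budgets for such powers. With [X = 2 ^ m], where [n <= X ^ 8 <= 256 n],
    losses are powers of [X] to be paid by one factor [1 / n]: the weight at a large base is only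
    bounded below by a multiple of [1 / X], the pairing with a polyexponential term costs [X], and
    squared distances to a base cost [n ^ (2 theta) <= X ^ 4], which is why [theta1 = 1/4]. On the
    disk the eigenvalues need not be real, so no positivity holds there; the bound
    [2 ^ - (8 (j + 2))] for [f] makes the contribution of each of them [O(n ^ - (j + 2))]. The
    remainder [c r] has no structure beyond its growth, so its pairing is controlled through
    absolute values of coefficients; this costs at most a multiple of [n ^ b], with [b] fixed by
    [f], and [r1 = j + 1 + b] pays for it. *)

Section Pairing.
Variable K : comNzRingType.
Implicit Types (u v : nat -> K) (P Q q : {poly K}) (l : K).

(** The linear functional on polynomials that sends [X^k] to [u k]. On the moments of a matrix model
    it is the expected trace of [P] at the matrix; on the sequence [l ^ k] it is evaluation at
    [l]. *)
Definition pairing u P : K := \sum_(k < size P) P`_k * u k.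

Lemma pairing_widen u P N :
  (size P <= N)%N -> pairing u P = \sum_(k < N) P`_k * u k.
Proof.
move=> sPN; rewrite /pairing -!(big_mkord xpredT (fun k => P`_k * u k)).
rewrite [RHS](big_cat_nat (n := size P)) //= [X in _ + X]big1_seq ?addr0 // => i.
by rewrite mem_index_iota => /andP[_ /andP[si _]]; rewrite nth_default ?mul0r.
Qed.

Lemma pairingD u P Q : pairing u (P + Q) = pairing u P + pairing u Q.
Proof.
pose N := maxn (size P) (size Q).
rewrite (@pairing_widen u _ N) ?size_polyD //.
rewrite (@pairing_widen u P N) ?leq_maxl // (@pairing_widen u Q N) ?leq_maxr //.
by rewrite -big_split; apply: eq_bigr => i _; rewrite coefD mulrDl.
Qed.

Lemma pairingZ u (a : K) P : pairing u (a *: P) = a * pairing u P.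
Proof.
rewrite (@pairing_widen u _ (size P)) ?size_scale_leq // mulr_sumr.
by apply: eq_bigr => i _; rewrite coefZ mulrA.
Qed.

Lemma pairingDl u v P : pairing (fun k => u k + v k) P = pairing u P + pairing v P.
Proof. by rewrite -big_split; apply: eq_bigr => i _; rewrite mulrDr. Qed.

Lemma pairingZl a u P : pairing (fun k => a * u k) P = a * pairing u P.
Proof. by rewrite mulr_sumr; apply: eq_bigr => i _; rewrite mulrCA. Qed.

Lemma pairing_suml I (s : seq I) (F : pred I) (u : I -> nat -> K) P :
  pairing (fun k => \sum_(i <- s | F i) u i k) P =
  \sum_(i <- s | F i) pairing (u i) P.
Proof.
by rewrite exchange_big; apply: eq_bigr => i _; rewrite mulr_sumr.
Qed.

Lemma pairingXM u P : pairing u ('X * P) = pairing (fun k => u k.+1) P.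
Proof.
have [->|P0] := eqVneq P 0; first by rewrite mulr0 /pairing size_poly0 !big_ord0.
rewrite (@pairing_widen u _ (size P).+1); last first.
  by rewrite mulrC size_mulX.
rewrite big_ord_recl coefXM /= mul0r add0r.
by apply: eq_bigr => i _; rewrite coefXM.
Qed.

Lemma pairing_geom l P : pairing (fun k => l ^+ k) P = P.[l].
Proof. by rewrite horner_coef. Qed.

Definition pexp q l (k : nat) : K := q.[k%:R] * l ^+ k.

Definition fwd_diff q : {poly K} := q \Po ('X + 1) - q.

(** Multiplication by [X] shifts the sequence, and [q(k+1) l^(k+1) - l q(k) l^k = l (q(k+1) - q(k))
    l^k]. *)
Lemma pairing_pexp_subX q l P :
  pairing (pexp q l) (('X - l%:P) * P) = l * pairing (pexp (fwd_diff q) l) P.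
Proof.
rewrite mulrBl pairingD -scaleN1r pairingZ mul_polyC pairingZ pairingXM.
rewrite -!pairingZl -pairingDl; apply: eq_bigr => k _; congr (_ * _).
rewrite /pexp /fwd_diff hornerD hornerN horner_comp hornerD hornerX -polyC1 hornerC.
by rewrite -natr1 exprS; ring.
Qed.

Lemma pairing_pexp_subXn q l d P :
  pairing (pexp q l) (('X - l%:P) ^+ d * P) =
  l ^+ d * pairing (pexp (iter d fwd_diff q) l) P.
Proof.
elim: d q => [|d IH] q; first by rewrite !expr0 !mul1r.
by rewrite exprS -mulrA pairing_pexp_subX IH exprS mulrA iterSr.
Qed.

(** The Euler operator [X d/dX] multiplies the [k]-th coefficient by [k], so a factor [k] of the
    sequence can be traded for a derivative of the test polynomial. *)
Lemma pairing_pexpMX q l P :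
  pairing (pexp (q * 'X) l) P = pairing (pexp q l) ('X * P^`()).
Proof.
rewrite [RHS](@pairing_widen _ _ (size P)); last first.
  have [->|P0] := eqVneq P 0; first by rewrite deriv0 mulr0.
  have [->|P'0] := eqVneq P^`() 0; first by rewrite mulr0 size_poly0.
  by rewrite mulrC size_mulX // lt_size_deriv.
apply: eq_bigr => k _; rewrite /pexp hornerMX coefXM coef_deriv.
case: k => [[|k] lk] /=; first by rewrite mulr0 mul0r mulr0 mul0r.
by rewrite -mulr_natr; ring.
Qed.

Lemma pairing_pexpD p q l P :
  pairing (pexp (p + q) l) P = pairing (pexp p l) P + pairing (pexp q l) P.
Proof. by rewrite -pairingDl; apply: eq_bigr => k _; rewrite /pexp hornerD mulrDl. Qed.

Lemma pairing_pexpC a l P : pairing (pexp a%:P l) P = a * P.[l].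
Proof.
by rewrite -pairing_geom -pairingZl; apply: eq_bigr => k _; rewrite /pexp hornerC.
Qed.

End Pairing.

(** * Annihilation of polyexponential terms by powers of [X - l] *)

Section ForwardDifference.
Variable K : numDomainType.
Implicit Types q P : {poly K}.

(** The leading coefficients cancel, and the next coefficient is the degree times the leading one,
    nonzero in characteristic zero. *)
Lemma size_fwd_diff q : size (fwd_diff q) = (size q).-1.
Proof.
rewrite /fwd_diff.
have sC n : size (('X + 1) ^+ n : {poly K}) = n.+1.
  by rewrite -[1]opprK -polyC1 -polyCN size_exp_XsubC.
have [sq1|sq1] := leqP (size q) 1.
  rewrite (size1_polyC sq1) comp_polyC subrr size_poly0.
  by rewrite size_polyC; case: (_ == 0).
case sq : (size q) sq1 => [//|[//|d]] _ /=.
have le1 : (size (q \Po ('X + 1) - q)%R <= d.+1)%N.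
  apply/leq_sizeP => i; rewrite leq_eqVlt => /predU1P[<-|di]; last first.
    rewrite !nth_default // ?sq // (leq_trans (size_polyD _ _)) // geq_max.
    rewrite size_polyN sq di andbT size_comp_poly2 ?sq //.
    by rewrite -polyC1 size_XaddC.
  rewrite coefB.
  have : lead_coef (q \Po ('X + 1)) = lead_coef q.
    rewrite lead_coef_comp ?(negbT _) //; last by rewrite -polyC1 size_XaddC.
    by rewrite -polyC1 lead_coefXaddC expr1n mulr1.
  rewrite /lead_coef size_comp_poly2; last by rewrite -polyC1 size_XaddC.
  by rewrite sq /= => ->; rewrite subrr.
apply/eqP; rewrite eqn_leq le1 /= ltnNge; apply/negP => /leq_sizeP /(_ d (leqnn _)).
rewrite coefB coef_comp_poly sq 2!big_ord_recr /=.
rewrite big1 ?add0r => [|i _]; last first.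
  by rewrite [X in _ * X]nth_default ?mulr0 // sC.
have c0 : (('X + 1) ^+ d : {poly K})`_d = 1.
  have := monic_exp d (monicXaddC (1 : K)); rewrite polyC1 => /monicP.
  by rewrite /lead_coef sC.
have c1 : (('X + 1) ^+ d.+1 : {poly K})`_d = d.+1%:R.
  elim: d {sq le1} c0 => [|d IH] c0; first by rewrite expr1 coefD coefX coef1 add0r.
  rewrite exprSr mulrDr mulr1 coefD coefMX /= c0 IH ?natr1 //.
  have := monic_exp d (monicXaddC (1 : K)); rewrite polyC1 => /monicP.
  by rewrite /lead_coef sC.
rewrite c0 c1 mulr1 addrAC subrr add0r => /eqP; rewrite mulf_eq0 pnatr_eq0 orbF.
have : lead_coef q != 0 by rewrite lead_coef_eq0 -size_poly_gt0 sq.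
by rewrite /lead_coef sq /= => /negPf ->.
Qed.

Lemma size_iter_fwd_diff d q : size (iter d (@fwd_diff K) q) = (size q - d)%N.
Proof. by elim: d => [|d IH] /=; rewrite ?subn0 // size_fwd_diff IH subnS. Qed.

Lemma pairing_pexp_eq0 q l d P : (size q <= d)%N ->
  pairing (pexp q l) (('X - l%:P) ^+ d * P) = 0.
Proof.
move=> sq; rewrite pairing_pexp_subXn.
have /eqP : size (iter d (@fwd_diff K) q) = 0%N.
  by apply/eqP; rewrite size_iter_fwd_diff subn_eq0.
by rewrite size_poly_eq0 => /eqP ->; rewrite -polyC0 pairing_pexpC mul0r mulr0.
Qed.

(** With exactly as many factors as the degree of [q], the differences leave a nonzero constant, and
    the pairing degenerates to evaluation at [l]. *)
Lemma pairing_pexp_lead q l d : size q = d.+1 ->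
  exists2 a : K, a != 0 &
    forall P, pairing (pexp q l) (('X - l%:P) ^+ d * P) = a * l ^+ d * P.[l].
Proof.
move=> sq.
have s1 : size (iter d (@fwd_diff K) q) = 1%N by rewrite size_iter_fwd_diff sq subSnn.
have /size_poly1P [a a0 E] : size (iter d (@fwd_diff K) q) == 1%N by rewrite s1.
by exists a => // P; rewrite pairing_pexp_subXn E pairing_pexpC mulrCA mulrA.
Qed.

End ForwardDifference.

Section ComplexModulus.
Variable R : realType.
Implicit Types (z : R[i]) (x : R).
Local Notation normc := Normc.normc.

Lemma normc_ge0 z : 0 <= normc z.
Proof. by case: z => a b; apply: sqrtr_ge0. Qed.

Lemma normc_real x : normc x%:C = `|x|.
Proof. by rewrite /normc /= expr0n addr0 sqrtr_sqr. Qed.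

Lemma normcX z k : normc (z ^+ k) = normc z ^+ k.
Proof.
by elim: k => [|k IH]; rewrite ?expr0 ?Normc.normc1 // !exprS Normc.normcM IH.
Qed.

Lemma ler_normcD z1 z2 : normc (z1 + z2) <= normc z1 + normc z2.
Proof. exact: le_normcD. Qed.

Lemma normcN z : normc (- z) = normc z.
Proof. exact: normcN. Qed.

Lemma normcBC z1 z2 : normc (z1 - z2) = normc (z2 - z1).
Proof. by rewrite -normcN opprB. Qed.

Lemma ler_normcB z1 z2 : normc z1 <= normc z2 + normc (z1 - z2).
Proof. by rewrite -{1}(subrK z2 z1) addrC ler_normcD. Qed.

Lemma ler_normc_sum I (s : seq I) (F : pred I) (h : I -> R[i]) :
  normc (\sum_(i <- s | F i) h i) <= \sum_(i <- s | F i) normc (h i).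
Proof.
elim/big_rec2: _ => [|i y1 y2 _ IH]; first by rewrite Normc.normc0.
by rewrite (le_trans (ler_normcD _ _)) // lerD2l.
Qed.

Lemma normc_eq0 z : (normc z == 0) = (z == 0).
Proof.
by apply/eqP/eqP => [/Normc.eq0_normc //|->]; rewrite Normc.normc0.
Qed.

Lemma normc_gt0 z : (0 < normc z) = (z != 0).
Proof. by rewrite lt_def normc_eq0 normc_ge0 andbT. Qed.

Lemma normc_ge_absRe z : `|complex.Re z| <= normc z.
Proof. by rewrite -lecR; apply: normc_ge_Re. Qed.

Lemma normc_natr n : normc n%:R = n%:R :> R.
Proof. by rewrite -(rmorph_nat (real_complex R)) normc_real normr_nat. Qed.

End ComplexModulus.

(** * Weighted sums of absolute values of coefficients *)

Section AbsoluteSum.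
Variable R : realType.
Implicit Types (P Q : {poly R}) (x r : R).
Local Notation normc := Normc.normc.

(** A submultiplicative norm. It dominates the supremum on the disk of radius [r] and, unlike that
    supremum, also the pairing with every sequence bounded by [r ^ k]. *)
Definition abs_sum P r : R := \sum_(k < size P) `|P`_k| * r ^+ k.

Lemma abs_sum_widen P r N :
  (size P <= N)%N -> abs_sum P r = \sum_(k < N) `|P`_k| * r ^+ k.
Proof.
move=> sPN; rewrite /abs_sum -!(big_mkord xpredT (fun k => `|P`_k| * r ^+ k)).
rewrite [RHS](big_cat_nat (n := size P)) //= [X in _ + X]big1_seq ?addr0 // => i.
by rewrite mem_index_iota => /andP[_ /andP[si _]]; rewrite nth_default ?normr0 ?mul0r.
Qed.

Lemma abs_sum_ge0 P r : 0 <= r -> 0 <= abs_sum P r.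
Proof. by move=> r0; apply: sumr_ge0 => k _; rewrite mulr_ge0 ?exprn_ge0. Qed.

Lemma abs_sumC a r : abs_sum a%:P r = `|a|.
Proof.
by rewrite (@abs_sum_widen _ _ 1) ?size_polyC_leq1 // big_ord1 coefC mulr1.
Qed.

Lemma abs_sum_MXaddC P a r :
  abs_sum (P * 'X + a%:P) r = abs_sum P r * r + `|a|.
Proof.
rewrite (@abs_sum_widen _ _ (size P).+1); last first.
  by rewrite size_MXaddC; case: ifP.
rewrite big_ord_recl /= coefD coefMX coefC /= add0r mulr1 addrC mulr_suml.
congr (_ + _); apply: eq_bigr => i _.
by rewrite coefD coefMX coefC /= addr0 exprSr mulrA.
Qed.

Lemma ler_abs_sumD P Q r : 0 <= r -> abs_sum (P + Q) r <= abs_sum P r + abs_sum Q r.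
Proof.
move=> r0; pose N := maxn (size P) (size Q).
rewrite (@abs_sum_widen _ r N) ?size_polyD //.
rewrite (@abs_sum_widen P r N) ?leq_maxl // (@abs_sum_widen Q r N) ?leq_maxr //.
rewrite -big_split; apply: ler_sum => i _ /=.
by rewrite -mulrDl coefD ler_wpM2r ?exprn_ge0 ?ler_normD.
Qed.

Lemma abs_sumZ a P r : abs_sum (a *: P) r = `|a| * abs_sum P r.
Proof.
rewrite (@abs_sum_widen _ _ (size P)) ?size_scale_leq // mulr_sumr.
by apply: eq_bigr => i _; rewrite coefZ normrM mulrA.
Qed.

Lemma ler_abs_sumM P Q r : 0 <= r -> abs_sum (P * Q) r <= abs_sum P r * abs_sum Q r.
Proof.
move=> r0; elim/poly_ind: P => [|P a IH].
  by rewrite mul0r -polyC0 !abs_sumC normr0 mul0r.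
rewrite mulrDl mul_polyC (le_trans (ler_abs_sumD _ _ r0)) // abs_sum_MXaddC mulrDl.
rewrite abs_sumZ lerD2r (_ : P * 'X * Q = P * Q * 'X + 0%:P); last first.
  by rewrite addr0 mulrAC.
by rewrite abs_sum_MXaddC normr0 addr0 mulrAC ler_wpM2r.
Qed.

Lemma ler_abs_sumX P n r : 0 <= r -> abs_sum (P ^+ n) r <= abs_sum P r ^+ n.
Proof.
move=> r0; elim: n => [|n IH]; first by rewrite !expr0 -polyC1 abs_sumC normr1.
by rewrite !exprS (le_trans (ler_abs_sumM _ _ r0)) // ler_wpM2l ?abs_sum_ge0.
Qed.

Local Notation toC := (map_poly (real_complex R)).

Lemma normc_horner_le (P : {poly R}) (z : R[i]) r :
  normc z <= r -> normc (toC P).[z] <= abs_sum P r.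
Proof.
move=> zr; rewrite (@horner_coef_wide _ (size P)) ?size_map_poly //.
rewrite (le_trans (ler_normc_sum _ _ _)) //; apply: ler_sum => k _.
rewrite coef_map Normc.normcM normcX normc_real ler_wpM2l // lerXn2r // ?nnegrE.
  exact: normc_ge0.
exact: le_trans (normc_ge0 _) zr.
Qed.

(** The constant term has to vanish because sequences live on the positive integers and [u 0] is
    uncontrolled. *)
Lemma normc_pairing_le (u : nat -> R[i]) P (A r : R) :
  P`_0 = 0 -> (forall k, (0 < k < size P)%N -> normc (u k) <= A * r ^+ k) ->
  normc (pairing u (toC P)) <= A * abs_sum P r.
Proof.
move=> P0 uA; rewrite (@pairing_widen _ _ _ (size P)) ?size_map_poly //.
rewrite (le_trans (ler_normc_sum _ _ _)) // mulr_sumr; apply: ler_sum => k _.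
rewrite coef_map Normc.normcM normc_real mulrCA.
case: (posnP k) => [->|k0]; first by rewrite P0 normr0 !mul0r.
by rewrite ler_wpM2l // uA // k0 /=.
Qed.

(** Induction on [q]: each degree is moved onto the test polynomial as an Euler derivative, which by
    the product rule brings out one factor [m]. As the derivative changes the cofactor of [f ^ m],
    the exponent [d] has to serve all [G] at once. *)
Lemma pairing_pexp_pow_le (f : {poly R[i]}) (l : R[i]) :
  normc f.[l] <= 1 -> forall q : {poly R[i]}, exists d : nat,
  forall G : {poly R[i]}, exists2 A : R, 0 <= A &
    forall m, normc (pairing (pexp q l) (f ^+ m * G)) <= A * m.+1%:R ^+ d.
Proof.
move=> fl1; elim/poly_ind => [|q a [d IH]].
  exists 0%N => G; exists 0 => // m.
  by rewrite -polyC0 pairing_pexpC mul0r Normc.normc0 mul0r.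
exists d.+1 => G.
have [A1 A10 HA1] := IH ('X * f^`() * G).
have [A2 A20 HA2] := IH ('X * G^`()).
exists (A1 + A2 + normc (a * G.[l])).
  by rewrite !addr_ge0 ?normc_ge0.
move=> m; rewrite pairing_pexpD pairing_pexpMX pairing_pexpC.
rewrite (_ : 'X * (f ^+ m * G)^`() =
   m%:R *: (f ^+ m.-1 * ('X * f^`() * G)) + f ^+ m * ('X * G^`())); last first.
  rewrite derivM deriv_exp scaler_nat -mulr_natr -[X in _ = X + _]mulr_natr.
  by move: m%:R => c; ring.
have m1 : 1 <= m.+1%:R ^+ d :> R by rewrite exprn_ege1 // ler1n.
rewrite !mulrDl pairingD pairingZ; apply: (le_trans (ler_normcD _ _)); apply: lerD.
  apply: (le_trans (ler_normcD _ _)); apply: lerD.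
    rewrite Normc.normcM normc_natr exprS [leRHS]mulrCA; apply: ler_pM; rewrite ?normc_ge0 ?ler0n ?ler_nat //.
    rewrite (le_trans (HA1 _)) // ler_wpM2l // lerXn2r ?nnegrE // ler_nat.
    by case: (m).
  by rewrite (le_trans (HA2 _)) // ler_wpM2l // exprS ler_peMl ?ler1n.
rewrite hornerM horner_exp [a * (_ * _)]mulrCA Normc.normcM normcX mulrC.
apply: ler_pM; rewrite ?exprn_ge0 ?normc_ge0 //.
rewrite (le_trans (exprn_ile1 _ _ _)) ?normc_ge0 //.
by rewrite exprn_ege1 // ler1n.
Qed.

End AbsoluteSum.

(** * Polynomial approximation of a step function *)

Section StepPolynomial.
Variable R : realType.
Implicit Types (x y r : R).

Lemma bernoulli x n : -1 <= x -> 1 + n%:R * x <= (1 + x) ^+ n.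
Proof.
move=> x1; elim: n => [|n IH]; first by rewrite mul0r addr0.
rewrite exprS; apply: (@le_trans _ _ ((1 + x) * (1 + n%:R * x))); last first.
  by rewrite ler_wpM2l // addrC -lerBlDr sub0r.
have : 0 <= n%:R * (x * x) by rewrite mulr_ge0 ?ler0n // -expr2 sqr_ge0.
by rewrite -natr1; move: n%:R => c; nra.
Qed.

(** Bernoulli's inequality for [1 - x], since [(1 + x) ^ n (1 - x) ^ n <= 1]. *)
Lemma ler_expr_bernoulli x n : 0 <= x -> n%:R * x < 1 ->
  (1 + x) ^+ n <= (1 - n%:R * x)^-1.
Proof.
case: n => [|n] x0 nx; first by rewrite mul0r subr0 invr1.
have x1 : x <= 1.
  have : 1 * x <= n.+1%:R * x by rewrite ler_wpM2r // ler1n.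
  by rewrite mul1r => /le_lt_trans -/(_ _ nx) /ltW.
rewrite -[leRHS]mul1r ler_pdivlMr ?subr_gt0 //.
apply: (@le_trans _ _ ((1 + x) ^+ n.+1 * (1 - x) ^+ n.+1)).
  rewrite ler_wpM2l ?exprn_ge0 ?addr_ge0 //.
  by rewrite -mulrN bernoulli // lerN2.
by rewrite -exprMn exprn_ile1 //; nra.
Qed.

Lemma exists_expr_lt x y : 0 <= x < 1 -> 0 < y -> exists n, x ^+ n < y.
Proof.
move=> /andP[x0 x1] y0.
have /cvgrPdist_lt/(_ _ y0) : x ^+ n @[n --> \oo] --> (0 : R).
  by apply: cvg_expr; rewrite ger0_norm.
case=> N _ /(_ N (leqnn _)) /=; rewrite sub0r normrN ger0_norm ?exprn_ge0 // => ?.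
by exists N.
Qed.

(* [f = 1 - (1 - (X / L) ^ (2 a)) ^ b], where the exponents are such that
   [b (r / L) ^ (2 a)] is small and [b (t / L) ^ (2 a) >= 1]. *)
Lemma step_poly (r t L e : R) : 0 < r -> r < t -> t <= L -> 0 < e -> e <= 1 ->
  exists f : {poly R}, [/\ f`_0 = 0, abs_sum f r <= e,
    forall x, `|x| <= L -> 0 <= f.[x] <= 1
  & forall x, t <= `|x| -> `|x| <= L -> 2^-1 <= f.[x]].
Proof.
move=> r0 rt tL e0 e1.
have t0 : 0 < t by apply: lt_trans rt.
have L0 : 0 < L by apply: lt_le_trans tL.
have [a Ha] : exists a, (r / t) ^+ a < e / 4.
  by apply: exists_expr_lt; rewrite ?divr_gt0 // divr_ge0 ?ltW //= ltr_pdivrMr ?mul1r.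
have a0 : (0 < a)%N by case: a Ha => //; rewrite expr0; lra.
pose s := (L / t) ^+ (a.*2).
have s1 : 1 <= s by rewrite exprn_ege1 // ler_pdivlMr ?mul1r.
(* As [s] is the inverse of [(t / L) ^ (2 a)], a [b] between [s] and [2 s] gives
   [b (t / L) ^ (2 a) >= 1] while [b (r / L) ^ (2 a) <= 2 (r / t) ^ (2 a)]. *)
pose b := (Num.trunc s).+1.
have [sb bs] : s <= b%:R /\ b%:R <= 2 * s.
  have s0 : 0 <= s by lra.
  have /andP[h1 /ltW h2] := truncn_itv s0; split => //.
  by rewrite /b -natr1; lra.
pose v := (r / L) ^+ (a.*2).
have v0 : 0 <= v by rewrite exprn_ge0 // divr_ge0 // ltW.
have bv : b%:R * v <= e / 2.
  apply: (@le_trans _ _ (2 * s * v)); first by rewrite ler_wpM2r.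
  rewrite -mulrA /s /v -exprMn (_ : L / t * (r / L) = r / t); last first.
    by field; rewrite !gt_eqF.
  suff : (r / t) ^+ a.*2 <= e / 4 by lra.
  apply: le_trans (ltW Ha); rewrite -addnn exprD ler_piMl //.
    by rewrite exprn_ge0 // divr_ge0 // ltW.
  by rewrite exprn_ile1 ?divr_ge0 ?ltW // ltr_pdivrMr ?mul1r.
pose w : {poly R} := (L ^- a.*2) *: 'X^(a.*2).
pose f := 1 - (1 - w) ^+ b.
(* Written as a multiple of [w], [f] has no constant term, and the geometric sum bounds its norm by
   [(1 + v) ^ b - 1]; estimating [1] and [(1 - w) ^ b] separately would lose the cancellation. *)
have fw : f = w * \sum_(i < b) (1 - w) ^+ i.
  by rewrite /f -opprB subrX1 -mulNr; congr (_ * _); ring.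
have wE x : w.[x] = (`|x| / L) ^+ a.*2.
  by rewrite hornerZ hornerXn expr_div_n mulrC -{1}mul2n exprM -real_normK ?num_real // -exprM mul2n.
have fE x : f.[x] = 1 - (1 - w.[x]) ^+ b.
  by rewrite /f !(hornerD, hornerN, horner_exp, hornerC).
have w01 x : `|x| <= L -> 0 <= w.[x] <= 1.
  move=> xL; rewrite wE exprn_ge0 ?divr_ge0 ?(ltW L0) //=.
  by rewrite exprn_ile1 ?divr_ge0 ?(ltW L0) // ler_pdivrMr ?mul1r.
exists f; split.
- by rewrite fw coefM big_ord1 coefZ coefXn; case: (a) a0 => // n _; rewrite mulr0 mul0r.
- have wv : abs_sum w r <= v.
    have Li : 0 <= L ^- a.*2 by rewrite invr_ge0 exprn_ge0 // ltW.
    rewrite abs_sumZ /v expr_div_n mulrC (ger0_norm Li) ler_wpM2r // (le_trans (ler_abs_sumX _ _ (ltW r0))) //.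
    rewrite -['X]addr0 -['X]mul1r -polyC1 -polyC0 abs_sum_MXaddC abs_sumC.
    by rewrite normr1 normr0 addr0 mul1r.
  have w1v : abs_sum (1 - w) r <= 1 + v.
    rewrite (le_trans (ler_abs_sumD _ _ (ltW r0))) // -scaleN1r abs_sumZ normrN1 mul1r.
    by rewrite -polyC1 abs_sumC normr1 lerD2l.
  apply: (@le_trans _ _ ((1 + v) ^+ b - 1)).
    rewrite fw subrX1 [1 + v]addrC addrK (le_trans (ler_abs_sumM _ _ (ltW r0))) //.
    rewrite ler_pM ?abs_sum_ge0 ?(ltW r0) //.
    elim: (b) => [|n IH]; first by rewrite !big_ord0 -polyC0 abs_sumC normr0.
    rewrite !big_ord_recr /= (le_trans (ler_abs_sumD _ _ (ltW r0))) // lerD //.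
    rewrite (le_trans (ler_abs_sumX _ _ (ltW r0))) // lerXn2r ?nnegrE ?abs_sum_ge0 ?(ltW r0) //.
      by rewrite addr_ge0.
    by rewrite addrC.
  rewrite lerBlDr (le_trans (ler_expr_bernoulli v0 _)) //; first by lra.
  rewrite -[leLHS]mul1r ler_pdivrMr; last by lra.
  have := mulr_ge0 (mulr_ge0 (ler0n R b) v0) (ltW e0).
  by move: (b%:R * v) bv => c cb; nra.
- move=> x /w01/andP[wx0 wx1]; rewrite fE.
  have h0 : 0 <= (1 - w.[x]) ^+ b by rewrite exprn_ge0 // subr_ge0.
  have h1 : (1 - w.[x]) ^+ b <= 1 by rewrite exprn_ile1 ?subr_ge0 //; lra.
  by rewrite subr_ge0 h1 lerBlDr lerDl.
- move=> x tx xL; have /andP[wx0 wx1] := w01 _ xL.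
  have bw : 1 <= b%:R * w.[x].
    apply: (@le_trans _ _ (s * w.[x])); last by rewrite ler_wpM2r.
    rewrite wE /s -exprMn exprn_ege1 // (_ : L / t * _ = `|x| / t).
      by rewrite ler_pdivlMr ?mul1r.
    by field; rewrite !gt_eqF.
  (* As the product is at most 1, the bound [(1 + w) ^ b >= 2] from Bernoulli forces
     [(1 - w) ^ b <= 1/2]. *)
  have h1 : (1 - w.[x]) ^+ b * (1 + w.[x]) ^+ b <= 1.
    by rewrite -exprMn exprn_ile1 //; nra.
  have h2 : 2 <= (1 + w.[x]) ^+ b.
    by rewrite (le_trans _ (bernoulli _ _)) //; lra.
  have h3 : 0 <= (1 - w.[x]) ^+ b by rewrite exprn_ge0 // subr_ge0.
  by rewrite fE; nra.
Qed.

End StepPolynomial.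

(** * Polyexponentials *)

Section Growth.
Variable R : realType.
Implicit Types (r e : R) (g h : nat -> R[i]) (q : {poly R[i]}) (l : R[i]).
Local Notation normc := Normc.normc.

Lemma of_growth_bound r g e : 0 < r -> of_growth r g -> 0 < e ->
  exists2 A : R, 0 <= A & forall k, normc (g k) <= A * (r + e) ^+ k.
Proof.
move=> r0 gr e0; have [N _ HN] := gr _ e0.
have re0 : 0 < r + e by rewrite addr_gt0.
pose A := 1 + \sum_(k < N) normc (g k) / (r + e) ^+ k.
have A1 : 1 <= A.
  by rewrite lerDl sumr_ge0 // => k _; rewrite divr_ge0 ?normc_ge0 ?exprn_ge0 // ltW.
exists A => [|k]; first exact: le_trans A1.
have [Nk|kN] := leqP N k.
  rewrite (le_trans (ltW (HN k Nk))) // ler_peMl // exprn_ge0 // ltW //.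
rewrite -ler_pdivrMr ?exprn_gt0 // /A (bigD1 (Ordinal kN)) //= addrCA lerDl.
rewrite addr_ge0 // sumr_ge0 // => i _.
by rewrite divr_ge0 ?normc_ge0 ?exprn_ge0 // ltW.
Qed.

(** The constant obtained for [e / 2] is outgrown by the powers of [(r + e) / (r + e / 2)]. *)
Lemma of_growth_intro r g : 0 <= r ->
  (forall e, 0 < e -> exists2 A : R, 0 <= A &
     forall k, normc (g k) <= A * (r + e) ^+ k) -> of_growth r g.
Proof.
move=> r0 gA e e0.
have e20 : 0 < e / 2 by rewrite divr_gt0.
have [A A0 HA] := gA _ e20.
have re0 : 0 < r + e by rewrite ltr_wpDl.
have re20 : 0 < r + e / 2 by rewrite ltr_wpDl.
have x01 : 0 <= (r + e / 2) / (r + e) < 1.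
  by rewrite divr_ge0 ?(ltW re0) ?(ltW re20) //= ltr_pdivrMr // mul1r ltrD2l; lra.
have A1 : 0 < A + 1 by rewrite ltr_wpDl.
have [|N HN] := exists_expr_lt x01 (y := (A + 1)^-1); first by rewrite invr_gt0.
exists N => // k /= Nk; apply: le_lt_trans (HA k) _.
have xk : ((r + e / 2) / (r + e)) ^+ k < (A + 1)^-1.
  apply: le_lt_trans HN; have /andP[x0 /ltW x1] := x01.
  by rewrite -(subnK Nk) exprD ler_piMl ?exprn_ge0 // exprn_ile1.
rewrite expr_div_n ltr_pdivrMr ?exprn_gt0 // in xk.
apply: (@le_lt_trans _ _ ((A + 1) * (r + e / 2) ^+ k)).
  by rewrite ler_wpM2r ?exprn_ge0 ?(ltW re20) // lerDl.
by rewrite -ltr_pdivlMl.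
Qed.

Lemma of_growth_eventually r g h :
  (\forall k \near \oo, g k = h k) -> of_growth r g -> of_growth r h.
Proof.
move=> gh gr e e0; have := gr e e0; move: gh; apply: filterS2.
by move=> k ->.
Qed.

Lemma of_growth_pos r g h :
  (forall k, (0 < k)%N -> g k = h k) -> of_growth r g -> of_growth r h.
Proof. by move=> gh; apply: of_growth_eventually; exists 1%N. Qed.

Lemma of_growth0 r : 0 <= r -> of_growth r (fun=> 0).
Proof.
move=> r0; apply: of_growth_intro => // e e0; exists 0 => // k.
by rewrite Normc.normc0 mul0r.
Qed.

Lemma of_growthD r g h : 0 < r -> of_growth r g -> of_growth r h ->
  of_growth r (fun k => g k + h k).
Proof.
move=> r0 gr hr; apply: of_growth_intro (ltW r0) _ => e e0.
have [A A0 HA] := of_growth_bound r0 gr e0.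
have [B B0 HB] := of_growth_bound r0 hr e0.
exists (A + B); first exact: addr_ge0.
by move=> k; rewrite (le_trans (ler_normcD _ _)) // mulrDl lerD.
Qed.

Lemma of_growthN r g : of_growth r g -> of_growth r (fun k => - g k).
Proof.
by move=> gr e e0; have := gr e e0; apply: filterS => k; rewrite normcN.
Qed.

Lemma of_growthB r g h : 0 < r -> of_growth r g -> of_growth r h ->
  of_growth r (fun k => g k - h k).
Proof. by move=> r0 gr hr; apply: of_growthD => //; apply: of_growthN. Qed.

Lemma of_growth_sum r I (s : seq I) (F : pred I) (g : I -> nat -> R[i]) : 0 < r ->
  (forall i, F i -> of_growth r (g i)) ->
  of_growth r (fun k => \sum_(i <- s | F i) g i k).
Proof.
move=> r0 gr; elim: s => [|i s IH].
  apply: of_growth_pos (of_growth0 (ltW r0)) => k _; by rewrite big_nil.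
case Fi: (F i); last first.
  by apply: of_growth_pos IH => k _; rewrite big_cons Fi.
by apply: of_growth_pos (of_growthD r0 (gr i Fi) IH) => k _; rewrite big_cons Fi.
Qed.

(** The factor [k] is absorbed into a slightly larger base, since Bernoulli gives
    [k y <= (1 + y) ^ k]. *)
Lemma of_growth_MX r g : 0 < r -> of_growth r g ->
  of_growth r (fun k => g k * k%:R).
Proof.
move=> r0 gr; apply: of_growth_intro (ltW r0) _ => e e0.
have e20 : 0 < e / 2 by rewrite divr_gt0.
have [A A0 HA] := of_growth_bound r0 gr e20.
have b0 : 0 < r + e / 2 by rewrite addr_gt0.
pose y := (e / 2) / (r + e / 2).
have y0 : 0 < y by rewrite divr_gt0.
exists (A / y) => [|k]; first by rewrite divr_ge0 // ltW.
rewrite Normc.normcM normc_natr.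
apply: (@le_trans _ _ (A * (r + e / 2) ^+ k * k%:R)); first by rewrite ler_wpM2r.
rewrite -!mulrA ler_wpM2l //.
have -> : r + e = (r + e / 2) * (1 + y).
  by rewrite /y; field; rewrite gt_eqF //; lra.
rewrite exprMn mulrCA ler_wpM2l ?exprn_ge0 ?(ltW b0) // mulrC ler_pdivlMr //.
apply: le_trans (bernoulli k _); first by rewrite lerDr.
by rewrite (le_trans _ (ltW y0)) // lerN10.
Qed.

Lemma of_growth_pexp r q l : 0 < r -> normc l <= r -> of_growth r (pexp q l).
Proof.
move=> r0 lr; elim/poly_ind: q => [|q a IH].
  by apply: of_growth_pos (of_growth0 (ltW r0)) => k _; rewrite /pexp horner0 mul0r.
have ha : of_growth r (fun k => a * l ^+ k).
  apply: of_growth_intro (ltW r0) _ => e e0; exists (normc a); first exact: normc_ge0.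
  move=> k; rewrite Normc.normcM ler_wpM2l ?normc_ge0 // normcX.
  rewrite lerXn2r ?nnegrE ?normc_ge0 ?addr_ge0 ?(ltW r0) ?(ltW e0) //.
  by rewrite (le_trans lr) // lerDl ltW.
apply: of_growth_pos (of_growthD r0 (of_growth_MX r0 IH) ha) => k _.
by rewrite /pexp hornerMXaddC; ring.
Qed.

Lemma succn_pow_le_expr d (b : R) : 1 < b ->
  exists2 A, 0 <= A & forall m, m.+1%:R ^+ d <= A * b ^+ m.
Proof.
move=> b1; have b10 : 0 < b - 1 by rewrite subr_gt0.
have g : of_growth 1 (pexp ('X^d : {poly R[i]}) 1).
  by apply: of_growth_pexp => //; rewrite Normc.normc1.
have [A A0 HA] := of_growth_bound ltr01 g b10.
exists (A * b) => [|m]; first by rewrite mulr_ge0 //; lra.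
have := HA m.+1; rewrite /pexp hornerXn expr1n mulr1 normcX normc_natr.
by rewrite (_ : 1 + (b - 1) = b) ?exprS ?mulrA //; lra.
Qed.

End Growth.

(** * Uniqueness of larger bases and of their coefficients *)

Section Uniqueness.
Variable R : realType.
Implicit Types (r : R) (Q f g z : nat -> R[i]) (q : {poly R[i]}) (l : R[i]).
Implicit Types (S L : {fset R[i]}) (p : R[i] -> {poly R[i]}).
Local Notation normc := Normc.normc.

Lemma pairingXnM (u : nat -> R[i]) t (P : {poly R[i]}) :
  pairing u ('X^t * P) = pairing (fun k => u (k + t)%N) P.
Proof.
elim: t u => [|t IH] u.
  by rewrite expr0 mul1r; apply: eq_bigr => k _; rewrite addn0.
rewrite exprS -mulrA pairingXM IH; apply: eq_bigr => k _.
by rewrite addnS.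
Qed.

(* Pairing with the multiples [X^t G] of a polynomial [G] that kills every term
   but the one of base [l] leaves a constant multiple of [l ^ t]. *)
Lemma pexp_sum_growth (s : seq R[i]) p l r : uniq s -> l \in s ->
  0 < r -> r < normc l ->
  of_growth r (fun k => \sum_(l' <- s) pexp (p l') l' k) -> p l = 0.
Proof.
move=> us ls r0 rl gu; apply/eqP; apply: contraT => pl0.
set u := (fun k => _) in gu.
have [d sd] : exists d, size (p l) = d.+1.
  by exists (size (p l)).-1; rewrite prednK // size_poly_gt0.
have [a a0 Ha] := pairing_pexp_lead l sd.
pose D := (\sum_(l' <- s) size (p l'))%N.
(* The exponent is 0 at [l] and elsewhere at least the size of every coefficient, so [H] kills all
   other terms without vanishing at [l]. *)
pose H := \prod_(l' <- s) ('X - l'%:P) ^+ ((l' != l) * D).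
pose G := ('X - l%:P) ^+ d * H.
have HG t : pairing u ('X^t * G) = a * l ^+ d * (l ^+ t * H.[l]).
  rewrite /u pairing_suml (bigD1_seq l) //= big1_seq ?addr0 => [|l' /andP[l'l l's]].
    by rewrite /G mulrCA Ha hornerM hornerXn.
  rewrite /G /H (bigD1_seq l') //= l'l mul1n.
  rewrite [X in pairing _ X](_ : _ = ('X - l'%:P) ^+ D * ('X^t * (('X - l%:P) ^+ d *
    \prod_(i <- s | i != l') ('X - i%:P) ^+ ((i != l) * D)))); last by ring.
  by rewrite pairing_pexp_eq0 // /D (bigD1_seq l') //= leq_addr.
have l0 : l != 0 by rewrite -normc_gt0 (lt_trans r0).
have Hl0 : H.[l] != 0.
  rewrite horner_prod prodf_seq_neq0; apply/allP => l' l's /=.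
  rewrite horner_exp expf_eq0 hornerXsubC subr_eq0.
  by case: (eqVneq l' l) => // _; rewrite andbF.
pose c := normc (a * l ^+ d * H.[l]).
have c0 : 0 < c by rewrite normc_gt0 !mulf_neq0 // expf_neq0.
have e0 : 0 < (normc l - r) / 2 by rewrite divr_gt0 ?subr_gt0.
have [A A0 HA] := of_growth_bound r0 gu e0.
set w := r + _ in HA.
have w0 : 0 < w by rewrite addr_gt0.
have wl : w < normc l by rewrite /w; lra.
pose B := \sum_(k < size G) normc G`_k * w ^+ k.
have B0 : 0 <= B by rewrite sumr_ge0 // => k _; rewrite mulr_ge0 ?normc_ge0 ?exprn_ge0 ?ltW.
have HB t : c * normc l ^+ t <= A * B * w ^+ t.
  rewrite /c -normcX -Normc.normcM.
  have -> : a * l ^+ d * H.[l] * l ^+ t = pairing u ('X^t * G) by rewrite HG; ring.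
  rewrite pairingXnM (le_trans (ler_normc_sum _ _ _)) // mulr_sumr mulr_suml; apply: ler_sum => k _.
  rewrite Normc.normcM (_ : _ * w ^+ t = normc G`_k * (A * w ^+ (k + t))).
    by rewrite ler_wpM2l ?normc_ge0.
  by rewrite exprD; ring.
have x01 : 0 <= w / normc l < 1.
  by rewrite divr_ge0 ?normc_ge0 ?(ltW w0) //= ltr_pdivrMr ?mul1r ?normc_gt0.
have AB1 : 0 < A * B + 1 by rewrite ltr_wpDl // mulr_ge0.
have [|t Ht] := exists_expr_lt x01 (y := c / (A * B + 1)); first exact: divr_gt0.
have := HB t; rewrite leNgt => /negP[].
rewrite expr_div_n ltr_pdivrMr ?exprn_gt0 ?normc_gt0 // in Ht.
rewrite mulrAC ltr_pdivlMr // in Ht; apply: le_lt_trans Ht.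
by rewrite mulrC ler_wpM2l ?exprn_ge0 ?(ltW w0) // lerDl.
Qed.

Definition exppoly S p k : R[i] := \sum_(l <- S) pexp (p l) l k.

(** Padding by zero lets coefficient families over different finite sets be compared base by
    base. *)
Definition extend0 S p l : {poly R[i]} := if l \in S then p l else 0.

Lemma pexp0 l k : pexp 0 l k = 0.
Proof. by rewrite /pexp horner0 mul0r. Qed.

Lemma exppoly_extend0 S L p k : (S `<=` L)%fset ->
  exppoly S p k = exppoly L (extend0 S p) k.
Proof.
move=> SL; rewrite /exppoly -(big_fset_incl _ SL) => [|l _ lS]; last first.
  by rewrite /extend0 (negPf lS) pexp0.
by apply: eq_big_seq => l lS; rewrite /extend0 lS.
Qed.

Lemma exppoly_unique S S' p p' l r : 0 < r -> r < normc l ->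
  of_growth r (fun k => exppoly S p k - exppoly S' p' k) ->
  extend0 S p l = extend0 S' p' l.
Proof.
move=> r0 rl gr; have [lL|] := boolP (l \in (S `|` S')%fset); last first.
  by rewrite in_fsetU negb_or /extend0 => /andP[/negPf -> /negPf ->].
apply/eqP; rewrite -subr_eq0; apply/eqP.
apply: (@pexp_sum_growth (S `|` S')%fset
  (fun l => extend0 S p l - extend0 S' p' l) _ r) => //.
  exact: fset_uniq.
apply: of_growth_pos gr => k _.
rewrite (exppoly_extend0 _ _ (fsubsetUl S S')) (exppoly_extend0 _ _ (fsubsetUr S S')).
rewrite /exppoly -sumrB; apply: eq_bigr => i _.
by rewrite /pexp hornerD hornerN mulrBl.
Qed.

(** The polyexponential part given by explicit bases and coefficients, in place of the minimal sets
    quantified over in [bases]. *)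
Definition large_part r Q S p : Prop :=
  [/\ forall l, l \in S -> r < normc l, forall l, l \in S -> p l != 0
    & of_growth r (fun k => Q k - exppoly S p k)].

Lemma polyexp_repr_exppoly L p z f k : polyexp_repr L p z f -> (0 < k)%N ->
  f k = exppoly L (fun l => if l == 0 then 0 else p l) k + z k.
Proof.
case=> _ _ fE k0; rewrite fE // big_mkcond; congr (_ + _); apply: eq_bigr => l _.
by case: eqP => //= _; rewrite pexp0.
Qed.

Lemma of_growth_eventually0 r z : 0 < r ->
  (\forall k \near \oo, z k = 0) -> of_growth r z.
Proof.
move=> r0 z0; apply: of_growth_eventually (of_growth0 (ltW r0)).
by apply: filterS z0 => k ->.
Qed.

Lemma large_part_exists r Q : 0 < r -> approx_polyexponential r Q ->
  exists S p, large_part r Q S p.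
Proof.
move=> r0 [f [g [[L [p [z Hf]]] gr QE]]].
pose p1 l := if l == 0 then 0 else p l.
pose S := [fset l in L | (r < normc l) && (p1 l != 0)]%fset.
exists S, p1; split.
- by move=> l; rewrite !inE /= => /and3P[].
- by move=> l; rewrite !inE /= => /and3P[].
have z0 : \forall k \near \oo, z k = 0 by case: Hf.
have gz := of_growthD r0 gr (of_growth_eventually0 r0 z0).
have go : of_growth r
    (fun k => \sum_(l <- L | ~~ ((r < normc l) && (p1 l != 0))) pexp (p1 l) l k).
  apply: of_growth_sum => // l; rewrite negb_and negbK -leNgt => /orP[lr|/eqP ->].
    exact: of_growth_pexp.
  by apply: of_growth_pos (of_growth0 (ltW r0)) => k _; rewrite pexp0.
apply: of_growth_pos (of_growthD r0 gz go) => k k0.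
rewrite QE // (polyexp_repr_exppoly Hf) // /exppoly.
rewrite -/p1 [X in _ = _ - X]big_fset /=.
rewrite [X in _ = X + _ + _ - _](bigID (fun l => (r < normc l) && (p1 l != 0))) /=.
by ring.
Qed.

Lemma exppoly_polyexponential_over S p f : 0 \notin S ->
  (forall k, (0 < k)%N -> f k = exppoly S p k) -> polyexponential_over S f.
Proof.
move=> S0 fE; exists p, (fun=> 0); split=> //; first by exists 0%N.
move=> k k0; rewrite fE // addr0 big_seq_cond /exppoly big_seq.
by apply: eq_bigl => l; case: eqP => [->|_]; rewrite ?(negPf S0) // andbT.
Qed.

(** Uniqueness above a positive threshold reaches every nonzero base: for the base [l] at hand the
    threshold [normc l / 2] is low enough, and the eventually vanishing term is of any positive
    growth. *)
Lemma polyexponential_over_subset S L p f :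
  0 \notin S -> (forall l, l \in S -> p l != 0) ->
  (forall k, (0 < k)%N -> f k = exppoly S p k) ->
  polyexponential_over L f -> (S `<=` L)%fset.
Proof.
move=> S0 pS fE [p' [z Hz]]; apply/fsubsetP => l lS.
have l0 : 0 < normc l by rewrite normc_gt0; apply: contraNneq S0 => <-.
have z0 : \forall k \near \oo, z k = 0 by case: Hz.
have r0 : 0 < normc l / 2 by rewrite divr_gt0.
have rl : normc l / 2 < normc l by lra.
have gd : of_growth (normc l / 2)
    (fun k => exppoly S p k - exppoly L (fun l => if l == 0 then 0 else p' l) k).
  apply: of_growth_pos (of_growth_eventually0 r0 z0) => k k0.
  by rewrite -fE // (polyexp_repr_exppoly Hz) // addrC addKr.
have := exppoly_unique r0 rl gd; rewrite /extend0 lS; case: (l \in L) => // /eqP.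
by rewrite (negPf (pS _ lS)).
Qed.

Lemma bases_exppoly S p f : 0 \notin S -> (forall l, l \in S -> p l != 0) ->
  (forall k, (0 < k)%N -> f k = exppoly S p k) -> bases f = [set` S].
Proof.
move=> S0 pS fE; have fS := exppoly_polyexponential_over S0 fE.
apply/seteqP; split => l /=.
  case=> L [fL minL] lL; have SL := polyexponential_over_subset S0 pS fE fL.
  have [->//|SneL] := eqVneq S L.
  by case: (minL S) => //; rewrite fproperEneq SneL.
move=> lS; exists S => //; split=> // L LS /(polyexponential_over_subset S0 pS fE).
by move=> SL; move: LS; rewrite fproperE SL andbF.
Qed.

Lemma notin0_large r Q S p : 0 < r -> large_part r Q S p -> 0 \notin S.
Proof.
move=> r0 [Sr _ _]; apply/negP => /Sr; rewrite Normc.normc0.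
by move=> /(lt_trans r0); rewrite ltxx.
Qed.

Lemma larger_bases_large r Q S p : 0 < r -> large_part r Q S p ->
  larger_bases r Q = [set` S].
Proof.
move=> r0 HS; have S0 := notin0_large r0 HS; have [Sr pS gr] := HS.
have bS := bases_exppoly S0 pS (f := exppoly S p) (fun _ _ => erefl).
apply/seteqP; split => l /=; last first.
  move=> lS; exists (exppoly S p); last by rewrite bS.
  split; first by exists S; apply: exppoly_polyexponential_over S0 _ => //.
    by rewrite bS => l' /Sr.
  by exists (fun k => Q k - exppoly S p k) => // k k0; rewrite addrC subrK.
case=> f [_ bf [g gg QE]] [L [[p' [z Hz]] minL] lL].
have rl : r < normc l by apply: bf; exists L => //; split=> //; exists p', z.
have l0 : l != 0 by rewrite -normc_gt0 (lt_trans r0).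
have z0 : \forall k \near \oo, z k = 0 by case: Hz.
have gd : of_growth r
    (fun k => exppoly L (fun l => if l == 0 then 0 else p' l) k - exppoly S p k).
  have := of_growthB r0 (of_growthB r0 gr gg) (of_growth_eventually0 r0 z0).
  apply: of_growth_pos => k k0.
  by rewrite QE // (polyexp_repr_exppoly Hz) //; ring.
have := exppoly_unique r0 rl gd; rewrite /extend0 lL (negPf l0); case: (boolP (l \in S)) => // lS p'l0.
have Ll : (L `\ l `<` L)%fset by rewrite fproperD1.
(* A base outside [S] would have zero coefficient, so [L] without it still represents [f], against
   minimality. *)
case: (minL _ Ll); exists p', z; case: Hz => _ L0 fE; split=> //.
  by rewrite in_fsetD1 eq_sym l0.
move=> k k0; rewrite fE //; congr (_ + _).
rewrite big_mkcond [RHS]big_mkcond (big_fsetD1 l) //= l0 p'l0 horner0 mul0r add0r.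
by [].
Qed.

Lemma polyexp_part_coef r Q S p (q : R[i] -> {poly R[i]}) l :
  0 < r -> large_part r Q S p -> r < normc l -> l \in S ->
  polyexp_part r Q (fun k => \sum_(l' \in [set` S]) (q l').[k%:R] * l' ^+ k) ->
  q l = p l.
Proof.
move=> r0 [Sr pS gr] rl lS [_ _ [g gg QE]].
have gd : of_growth r
    (fun k => exppoly S q k - exppoly S p k).
  apply: of_growth_pos (of_growthB r0 gr gg) => k k0.
  by rewrite QE // -fsbig_seq ?fset_uniq // -/(exppoly S q k); ring.
by have := exppoly_unique r0 rl gd; rewrite /extend0 lS.
Qed.

End Uniqueness.

(** * Linear spectral statistics *)

Section TracePowers.
Variable C : numClosedFieldType.

Lemma is_trig_mx_expr n (T : 'M[C]_n) k : is_trig_mx T ->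
  is_trig_mx (T ^+ k) /\ forall i, (T ^+ k) i i = T i i ^+ k.
Proof.
move=> /is_trig_mxP Tt; elim: k => [|k [/is_trig_mxP Tkt Tkd]].
  split=> [|i]; rewrite ?expr0.
    by apply/is_trig_mxP => i j ij; rewrite mxE -val_eqE /= ltn_eqF.
  by rewrite mxE eqxx.
have TE : T ^+ k.+1 = T *m T ^+ k by rewrite exprS.
split=> [|i]; rewrite TE.
  apply/is_trig_mxP => i j ij; rewrite mxE big1 // => m _.
  have [im|mi] := ltnP i m; first by rewrite Tt ?mul0r.
  by rewrite Tkt ?mulr0 // (leq_ltn_trans mi).
rewrite mxE (bigD1 i) //= big1 ?addr0 ?Tkd ?exprS // => m mi.
case: (ltngtP i m) => [im|mi'|/val_inj im]; first by rewrite Tt ?mul0r.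
  by rewrite Tkt ?mulr0.
by rewrite im eqxx in mi.
Qed.

Lemma char_poly_conj n (P A : 'M[C]_n) : P \in unitmx ->
  char_poly (P *m A *m invmx P) = char_poly A.
Proof.
move=> Pu; rewrite /char_poly.
have PP : map_mx polyC P *m map_mx polyC (invmx P) = 1%:M.
  by rewrite -map_mxM mulmxV // map_mx1.
have -> : char_poly_mx (P *m A *m invmx P) =
    map_mx polyC P *m char_poly_mx A *m map_mx polyC (invmx P).
  rewrite /char_poly_mx mulmxBr mulmxBl !map_mxM; congr (_ - _).
  by rewrite scalar_mxC -mulmxA PP mulmx1.
by rewrite !det_mulmx mulrAC -det_mulmx PP det1 mul1r.
Qed.

(** Schur triangularisation: powers of a triangular matrix carry the powers of its diagonal, and the
    diagonal is a permutation of the roots of the characteristic polynomial. *)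
Lemma mxtrace_expr_roots n (A : 'M[C]_n) (s : seq C) k :
  \prod_(z <- s) ('X - z%:P) = char_poly A ->
  \tr (A ^+ k) = \sum_(z <- s) z ^+ k.
Proof.
case: n A => [|n] A sE.
  have /size0nil -> : size s = 0%N.
    have /(congr1 (fun p : {poly C} => size p)) := sE.
    by rewrite size_char_poly size_prod_XsubC => -[].
  by rewrite big_nil /mxtrace big_ord0.
have [P /unitarymx_unit Pu] := Schur A (ltn0Sn n).
rewrite /similar_to conjumx //; set T := P *m A *m invmx P => Tt.
have AE j : A ^+ j = invmx P *m T ^+ j *m P.
  elim: j => [|j IH]; first by rewrite !expr0 mulmx1 mulVmx.
  have E : T *m T ^+ j = T ^+ j.+1 by rewrite exprS.
  rewrite exprS -[A * _]/(A *m _) IH -E /T !mulmxA mulVmx // mul1mx.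
  by rewrite -!mulmxA.
have [_ Td] := is_trig_mx_expr k Tt.
rewrite AE mxtrace_mulC mulmxA mulmxV // mul1mx /mxtrace (eq_bigr _ (fun i _ => Td i)).
rewrite -(char_poly_conj A Pu) -/T char_poly_trig // in sE.
rewrite -(big_map (fun i => T i i) xpredT (fun z => 'X - z%:P)) in sE.
rewrite -(big_map (fun i => T i i) xpredT (fun z => z ^+ k)).
exact/esym/perm_big/prod_XsubC_eq.
Qed.

End TracePowers.

Section LinearStatistics.
Variable R : realType.
Implicit Types (phi psi : R[i] -> R) (Q : {poly R}).
Local Notation normc := Normc.normc.
Local Notation toC := (map_poly (real_complex R)).

(** Eigenvalue counts and traces of test polynomials both have this form, so bounds between them
    reduce to pointwise inequalities at the possible eigenvalues. *)
Definition linear_stat n (P : matrix_probspace R n) phi : R :=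
  expectation_mx P (fun M => \sum_(z <- spectrum M) phi z).

Lemma size_spectrum n (M : 'M[R]_n) : size (spectrum M) = n.
Proof.
have /(congr1 (fun p : {poly R[i]} => size p)) := prod_spectrum M.
by rewrite size_char_poly size_prod_XsubC => -[].
Qed.

Section FixedSpace.
Variables (n : nat) (P : matrix_probspace R n).

Lemma EinE (A : set R[i]) : Ein P A = linear_stat P (fun z => (z \in A)%:R).
Proof.
apply: eq_bigr => M _; congr (_ * _); elim: (spectrum M) => [|z s IH].
  by rewrite big_nil.
by rewrite big_cons /= natrD IH.
Qed.

Lemma linear_statD phi psi :
  linear_stat P (fun z => phi z + psi z) = linear_stat P phi + linear_stat P psi.
Proof.
by rewrite -big_split; apply: eq_bigr => M _; rewrite big_split mulrDr.
Qed.

Lemma linear_stat_sum I (s : seq I) (B : pred I) (phi : I -> R[i] -> R) :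
  linear_stat P (fun z => \sum_(i <- s | B i) phi i z) =
  \sum_(i <- s | B i) linear_stat P (phi i).
Proof.
rewrite exchange_big; apply: eq_bigr => M _.
by rewrite exchange_big mulr_sumr.
Qed.

Lemma linear_statZ (a : R) phi :
  linear_stat P (fun z => a * phi z) = a * linear_stat P phi.
Proof.
rewrite /linear_stat /expectation_mx mulr_sumr; apply: eq_bigr => M _.
by rewrite -mulr_sumr mulrCA.
Qed.

Lemma linear_stat_cst (a : R) : linear_stat P (fun=> a) = n%:R * a.
Proof.
rewrite /linear_stat /expectation_mx.
rewrite (eq_bigr (fun M => prob P M * (n%:R * a))) => [|M _].
  by rewrite -mulr_suml prob_sum1 mul1r.
by rewrite big_const_seq count_predT size_spectrum iter_addr addr0 mulr_natl.
Qed.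

Lemma ler_linear_stat phi psi :
  (forall M z, M \in atoms P -> z \in spectrum M -> phi z <= psi z) ->
  linear_stat P phi <= linear_stat P psi.
Proof.
move=> le; rewrite /linear_stat /expectation_mx big_seq [leRHS]big_seq.
apply: ler_sum => M MP; rewrite ler_wpM2l ?(ltW (prob_gt0 MP)) //.
rewrite big_seq [leRHS]big_seq; apply: ler_sum => z zM; exact: le MP zM.
Qed.

(** The trace of a real polynomial at a real matrix is real, so passing to real parts eigenvalue by
    eigenvalue does not change the sum. *)
Lemma pairing_trace Q :
  pairing (fun k => (expectation_mx P (fun M => \tr (M ^+ k)))%:C) (toC Q) =
  (linear_stat P (fun z => complex.Re (toC Q).[z]))%:C.
Proof.
have trE (M : 'M[R]_n) : \sum_(k < size Q) Q`_k * \tr (M ^+ k) =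
    \sum_(z <- spectrum M) complex.Re (toC Q).[z].
  have trC : (\sum_(k < size Q) Q`_k * \tr (M ^+ k))%:C =
      \sum_(z <- spectrum M) (toC Q).[z].
    rewrite rmorph_sum /=.
    under eq_bigr => k _.
      rewrite rmorphM /= (_ : (\tr (M ^+ k))%:C = \sum_(z <- spectrum M) z ^+ k).
        rewrite mulr_sumr; over.
      rewrite -(@mxtrace_expr_roots _ n (map_mx (real_complex R) M)) ?prod_spectrum //.
      rewrite -rmorphXn trace_map_mx //.
    rewrite exchange_big; apply: eq_bigr => z _.
    rewrite (@horner_coef_wide _ (size Q)) ?size_map_poly //.
    by apply: eq_bigr => k _; rewrite coef_map.
  rewrite -[LHS]/(complex.Re (_%:C)) trC.
  elim: (spectrum M) => [|z s IH]; first by rewrite !big_nil.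
  by rewrite !big_cons -IH; case: (_.[z]) => a b; case: (bigop _ _ _).
rewrite (@pairing_widen _ _ _ (size Q)) ?size_map_poly // /linear_stat /expectation_mx.
under [in RHS]eq_bigr => M _ do rewrite -trE.
rewrite rmorph_sum /=.
under eq_bigr => k _ do rewrite coef_map rmorph_sum /= mulr_sumr.
rewrite exchange_big; apply: eq_bigr => M _.
rewrite rmorphM rmorph_sum mulr_sumr; apply: eq_bigr => k _.
by rewrite !rmorphM mulrCA.
Qed.

End FixedSpace.
End LinearStatistics.

(** * The logarithmic exponent and the powers of [n] it produces *)

Section Scale.
Implicit Types n : nat.

(* [2 ^ scale n] is of the order of the eighth root of [n]. *)
Definition scale n := (trunc_log 2 n %/ 8).+1.

Lemma leq_scale_expn n : (n <= 2 ^ (8 * scale n))%N.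
Proof.
case: n => [//|n]; apply: ltnW; apply: leq_trans (trunc_log_ltn n.+1 (ltnSn 1)) _.
by rewrite leq_exp2l // /scale mulnS {1}(divn_eq (trunc_log 2 n.+1) 8) mulnC addnC -addSn leq_add2r ltn_mod.
Qed.

Lemma expn_scale_leq n : (0 < n)%N -> (2 ^ (8 * scale n) <= 2 ^ 8 * n)%N.
Proof.
move=> n0; rewrite /scale mulnS expnD leq_mul2l /=.
apply: leq_trans (trunc_logP (ltnSn 1) n0).
by rewrite leq_exp2l // mulnC leq_divM.
Qed.

Lemma near_scale M : \forall n \near \oo, (M <= scale n)%N.
Proof.
exists (2 ^ (8 * M)).+1 => // n /= Mn; rewrite leqNgt; apply/negP => sM.
have := leq_scale_expn n; rewrite leqNgt => /negP[].
by rewrite (leq_ltn_trans _ Mn) // leq_exp2l // leq_mul2l ltnW ?orbT.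
Qed.

End Scale.

Section ScaleReal.
Variable R : realType.
Implicit Types n : nat.

Definition scaleX n : R := 2 ^+ scale n.

Lemma scaleX_ge1 n : 1 <= scaleX n.
Proof. by rewrite exprn_ege1 // ler1n. Qed.

Lemma scaleX_gt0 n : 0 < scaleX n.
Proof. exact: lt_le_trans (scaleX_ge1 n). Qed.

Lemma ler_scaleX n : n%:R <= scaleX n ^+ 8.
Proof. by rewrite /scaleX -exprM mulnC -natrX ler_nat leq_scale_expn. Qed.

(* Locked, lest unification unfolds the numeral. *)
Definition scale_const : R := locked 256%:R.

Lemma scale_const_ge0 : 0 <= scale_const.
Proof. by rewrite /scale_const -lock. Qed.

Lemma scaleX_le n : (0 < n)%N -> scaleX n ^+ 8 <= scale_const * n%:R.
Proof.
move=> n0; rewrite /scale_const -lock /scaleX -exprM mulnC -natrX -natrM ler_nat.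
exact: expn_scale_leq.
Qed.

Lemma near_scaleX (M : R) : \forall n \near \oo, M <= scaleX n.
Proof.
near=> n; apply: (@le_trans _ _ (scale n)%:R); last first.
  by rewrite /scaleX -natrX ler_nat ltnW // ltn_expl.
apply: (@le_trans _ _ (Num.bound `|M|)%:R).
  by rewrite (le_trans (ler_norm M)) // ltW // archi_boundP.
rewrite ler_nat; near: n; exact: near_scale.
Unshelve. all: by end_near. Qed.

(** For [scale n >= 2] the predecessor is at least half of [scale n], which turns the exponent
    [8 * (scale n).-1] into [4 * scale n]. *)
Lemma scale_ln n : (1 < scale n)%N -> (scale n)%:R * (4 * ln 2) <= ln n%:R :> R.
Proof.
move=> s1; have n0 : (0 < n)%N by case: n s1.
have h : (2 ^ (8 * (scale n).-1) <= n)%N.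
  rewrite -(@leq_pmul2l (2 ^ 8)) // -expnD -mulnS prednK //.
  exact: expn_scale_leq.
have : ln (2 ^+ (8 * (scale n).-1)) <= ln n%:R :> R.
  rewrite ler_ln ?posrE ?exprn_gt0 ?ltr0n //.
  by rewrite -natrX ler_nat.
rewrite lnXn // => h2; apply: le_trans h2.
rewrite -[leRHS]mulr_natl mulrA ler_wpM2r ?ln_ge0 ?ler1n //.
rewrite -natrM ler_nat; case: (scale n) s1 => [|[|s]] // _ /=.
by rewrite mulnC -[8%N]/(4 * 2)%N -mulnA leq_mul2l mul2n -addnn addnS ltnS leq_addr.
Qed.

End ScaleReal.

#[local] Hint Extern 0 (is_true (0 <= scale_const _)) => exact: scale_const_ge0 : core.

(** * Estimates on balls of radius [n ^ - theta] *)

Section RadiusEstimates.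
Variable R : realType.
Implicit Types (th e x y : R) (n m : nat).
Local Notation X := (scaleX R).
Local Notation kappa := (scale_const R).

Lemma powR_radius th n : (0 < n)%N -> 0 < th -> th <= 4^-1 ->
  [/\ 1 <= n%:R `^ th, (n%:R `^ th) ^+ 2 <= X n ^+ 4 & n%:R `^ (- th) = (n%:R `^ th)^-1].
Proof.
move=> n0 th0 th4; have N1 : 1 <= n%:R :> R by rewrite ler1n.
have D0 : 0 <= n%:R `^ th by exact: powR_ge0.
split; last exact: powRN.
  by rewrite -[leLHS](powRr0 n%:R) ler_powR // ltW.
have D4 : (n%:R `^ th) ^+ 4 <= (X n ^+ 2) ^+ 4.
  rewrite -powR_mulrn // -powRrM -exprM (le_trans _ (ler_scaleX R n)) //.
  rewrite -[leRHS]powRr1 ?ler0n // ler_powR //.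
  by move: th4; lra.
have X0 := scaleX_gt0 R n.
rewrite ler_pXn2r ?nnegrE ?exprn_ge0 ?(ltW X0) // in D4.
rewrite (_ : X n ^+ 4 = (X n ^+ 2) ^+ 2); last by rewrite -exprM.
by rewrite lerXn2r ?nnegrE ?exprn_ge0 ?(ltW X0).
Qed.

(** Raising to the power [scale n] magnifies relative variation over a ball of radius [n ^ - th] by
    about [scale n]; this factor must be harmless. With [b = 2 ^ (4 th)] it is [O(b ^ scale n)],
    while [n ^ th] is at least a positive multiple of [b ^ (2 scale n)]. *)
Lemma near_scale_powR th e : 0 < th -> 0 < e ->
  \forall n \near \oo, (scale n).+1%:R * n%:R `^ (- th) <= e.
Proof.
move=> th0 e0; pose b := 2 `^ (4 * th) : R.
have b1 : 1 < b.
  have E : 1 `^ (4 * th) = 1 :> R by rewrite powR1.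
  by rewrite -[ltLHS]E gt0_ltr_powR ?nnegrE ?ltr1n // mulr_gt0.
have b0 : 0 < b by apply: lt_trans b1.
have [A A0 HA] := succn_pow_le_expr 1 b1.
pose C := A * kappa `^ th.
have C0 : 0 <= C by rewrite mulr_ge0 ?powR_ge0.
have bi : 0 <= b^-1 < 1 by rewrite invr_ge0 (ltW b0) invf_lt1.
have [|M HM] := exists_expr_lt bi (y := e / (C + 1)).
  by rewrite divr_gt0 // ltr_wpDl.
near=> n; have n0 : (0 < n)%N by near: n; exact: nbhs_infty_gt.
have sM : (M <= scale n)%N by near: n; exact: near_scale.
have bE : b ^+ scale n = X n `^ (4 * th).
  by rewrite -powR_mulrn ?(ltW b0) // /b -powRrM mulrC [LHS]powRrM powR_mulrn.
have bb : b ^+ scale n * b ^+ scale n <= kappa `^ th * n%:R `^ th.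
  rewrite bE -powRM ?(ltW (scaleX_gt0 _ _)) // -expr2.
  rewrite -powRM ?ler0n // powRrM ge0_ler_powR ?(ltW th0) ?nnegrE //.
  - by rewrite powR_ge0.
  - by rewrite mulr_ge0.
  - by rewrite powR_mulrn ?sqr_ge0 // -exprM scaleX_le.
have N0 : 0 < n%:R `^ th :> R by rewrite powR_gt0 // ltr0n.
have bn : 0 < b ^+ scale n by rewrite exprn_gt0.
rewrite powRN ler_pdivrMr //.
apply: (@le_trans _ _ (A * b ^+ scale n)); first by have := HA (scale n); rewrite expr1.
have h : C * b^-1 ^+ scale n <= e.
  apply: (@le_trans _ _ ((C + 1) * (e / (C + 1)))); last first.
    by rewrite mulrCA mulfV ?mulr1 // gt_eqF // ltr_wpDl.
  apply: ler_pM; rewrite ?exprn_ge0 ?(andP bi).1 ?lerDl //.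
  apply: le_trans (ltW HM); rewrite -(subnK sM) exprD ler_piMl ?exprn_ge0 ?(andP bi).1 //.
  by rewrite exprn_ile1 ?(andP bi).1 // ltW // (andP bi).2.
have := ler_wpM2r (ltW N0) h; apply: le_trans.
rewrite /C exprVn -!mulrA ler_wpM2l // mulrCA ler_pdivlMl //.
Unshelve. all: by end_near. Qed.

Lemma poly_lipschitz (P : {poly R}) y L : exists2 A : R, 0 <= A &
  forall x, `|x| <= L -> `|P.[x] - P.[y]| <= A * `|x - y|.
Proof.
have /factor_theorem[Q PQ] : root (P - P.[y]%:P) y.
  by rewrite rootE hornerD hornerN hornerC subrr.
exists (abs_sum Q `|L|) => [|x xL]; first exact: abs_sum_ge0.
have -> : P.[x] - P.[y] = Q.[x] * (x - y).
  have := congr1 (fun P : {poly R} => P.[x]) PQ.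
  by rewrite hornerM hornerXsubC hornerD hornerN hornerC.
rewrite normrM ler_wpM2r //.
have := @normc_horner_le R Q x%:C `|L|.
rewrite horner_map !normc_real; apply; exact: le_trans (ler_norm L).
Qed.

Lemma product_close (u u' g g' a : R) m : 0 < u -> 0 < g -> 0 <= a ->
  m.+1%:R * a <= 2^-1 -> `|u' - u| <= a * u -> `|g' - g| <= a * g ->
  `|u' ^+ m * g' - u ^+ m * g| <= 2 * (m.+1%:R * a) * (u ^+ m * g).
Proof.
move=> u0 g0 a0 ma; rewrite !ler_distl => /andP[u1 u2] /andP[g1 g2].
have a1 : a <= 1.
  have : 1 * a <= m.+1%:R * a by rewrite ler_wpM2r // ler1n.
  by move: ma; lra.
have w0 : 0 < u ^+ m * g by rewrite mulr_gt0 // exprn_gt0.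
have lo : (1 - a) ^+ m.+1 * (u ^+ m * g) <= u' ^+ m * g'.
  rewrite exprSr mulrACA -exprMn; apply: ler_pM.
  - by rewrite exprn_ge0 // mulr_ge0 ?subr_ge0 // ltW.
  - by rewrite mulr_ge0 ?subr_ge0 // ltW.
  - apply: lerXn2r; rewrite ?nnegrE ?mulr_ge0 ?subr_ge0 ?(ltW u0) //.
      by apply: le_trans u1; nra.
    by move: u1; lra.
  - by move: g1; lra.
have hi : u' ^+ m * g' <= (1 + a) ^+ m.+1 * (u ^+ m * g).
  have u'0 : 0 <= u' by apply: le_trans u1; nra.
  have g'0 : 0 <= g' by apply: le_trans g1; nra.
  rewrite exprSr mulrACA -exprMn; apply: ler_pM; rewrite ?exprn_ge0 //.
  - apply: lerXn2r; rewrite ?nnegrE //.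
      by rewrite mulr_ge0 ?addr_ge0 // ltW.
    by move: u2; lra.
  - by move: g2; lra.
have lo' : 1 - m.+1%:R * a <= (1 - a) ^+ m.+1.
  by rewrite -mulrN bernoulli // lerN2.
have hi' : (1 + a) ^+ m.+1 <= 1 + 2 * (m.+1%:R * a).
  rewrite (le_trans (ler_expr_bernoulli a0 _)) //; first by move: ma; lra.
  have := mulr_ge0 (ler0n R m.+1) a0; move: (m.+1%:R * a) ma => s s2 s0.
  by rewrite -[leLHS]mul1r ler_pdivrMr; nra.
have lo2 := ler_wpM2r (ltW w0) lo'; have hi2 := ler_wpM2r (ltW w0) hi'.
have := mulr_ge0 (mulr_ge0 (ler0n R m.+1) a0) (ltW w0).
move: (m.+1%:R * a) lo lo2 hi hi2 => s lo lo2 hi hi2 sw; apply/andP; split; nra.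
Qed.

Lemma seq_gap (a : R) (s : seq R) : a \notin s ->
  exists g : R, [/\ 0 < g, g <= 1 & forall y, y \in s -> g <= `|a - y|].
Proof.
elim: s => [|b s IH]; first by exists 1.
rewrite in_cons negb_or => /andP[ab /IH[g [g0 g1 gs]]].
exists (Num.min g `|a - b|); split.
- by rewrite lt_min g0 normr_gt0 subr_eq0.
- by rewrite ge_min g1.
- by move=> y; rewrite in_cons => /predU1P[->|/gs gy]; rewrite ge_min ?lexx ?gy ?orbT.
Qed.

(* A point is close to at most one of finitely many distinct reals, so only one
   factor of the product can be small. *)
Lemma prod_dist_ge (s : seq R) (e : R -> nat) (k : R) : uniq s -> 0 < k -> k <= 1 ->
  exists2 c : R, 0 < c & forall x d, 0 <= d -> d <= 1 ->
    (forall y, y \in s -> d <= `|x - y|) ->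
    (forall y, y \in s -> e y != 1%N -> k <= `|x - y|) ->
    c * d <= \prod_(y <- s) `|x - y| ^+ e y.
Proof.
move=> us k0 k1; elim: s us => [_|a s IH /andP[/seq_gap[g [g0 g1 gs]] /IH[c c0 Hc]]].
  by exists 1 => // x d d0 d1 _ _; rewrite big_nil mul1r.
have g20 : 0 < g / 2 by rewrite divr_gt0.
have g21 : g / 2 <= 1 by lra.
pose P := \prod_(y <- s) (g / 2) ^+ e y.
have P0 : 0 < P by rewrite prodr_gt0 // => y _; rewrite exprn_gt0.
exists (Num.min ((g / 2) ^+ e a * c) (k ^+ e a * P)).
  by rewrite lt_min !mulr_gt0 // exprn_gt0.
move=> x d d0 d1 ds ks; rewrite big_cons.
have dss y : y \in s -> d <= `|x - y| by move=> ys; apply: ds; rewrite in_cons ys orbT.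
have kss y : y \in s -> e y != 1%N -> k <= `|x - y|.
  by move=> ys; apply: ks; rewrite in_cons ys orbT.
have [xa|xa] := leP (g / 2) `|x - a|.
  apply: (@le_trans _ _ ((g / 2) ^+ e a * c * d)).
    by rewrite ler_wpM2r // ge_min lexx.
  rewrite -mulrA ler_pM ?exprn_ge0 ?(ltW g20) ?Hc //.
    by rewrite mulr_ge0 // ltW.
  by rewrite lerXn2r ?nnegrE // ltW.
apply: (@le_trans _ _ (k ^+ e a * P * d)).
  by rewrite ler_wpM2r // ge_min lexx orbT.
rewrite mulrAC ler_pM ?(ltW P0) //.
- by rewrite mulr_ge0 // exprn_ge0 // ltW.
- have da : d <= `|x - a| by apply: ds; rewrite mem_head.
  have ka : e a != 1%N -> k <= `|x - a| by apply: ks; rewrite mem_head.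
  case: (eqVneq (e a) 1%N) ka => [-> _|_ /(_ isT) ka].
    by rewrite !expr1; apply: le_trans da; rewrite ler_piMl.
  apply: (@le_trans _ _ (k ^+ e a)); first by rewrite ler_piMr // exprn_ge0 // ltW.
  by rewrite lerXn2r ?nnegrE // ltW.
- rewrite /P big_seq [leRHS]big_seq; apply: ler_prod => y ys.
  rewrite exprn_ge0 ?(ltW g20) //= lerXn2r ?nnegrE // ?(ltW g20) //.
  have := gs y ys; have := ler_distD x a y.
  by rewrite (distrC a x); move: xa; lra.
Qed.

End RadiusEstimates.

(** * Test polynomials *)

Section WeightedTrace.
Variables (R : realType) (L0 L1 eps : R) (j b r : nat) (f : {poly R}).
Variables (MM : matrix_model R) (c : nat -> nat -> R[i]).
Variables (S : {fset R[i]}) (p : R[i] -> {poly R[i]}).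
Local Notation normc := Normc.normc.
Local Notation toC := (map_poly (real_complex R)).
Local Notation F := (model_oo MM).
Local Notation X := (scaleX R).
Local Notation kappa := (scale_const R).

Hypothesis L0_gt0 : 0 < L0.
Hypothesis eps_gt0 : 0 < eps.
Hypothesis L0_eps_le : L0 + eps <= L1.
Hypothesis f_coef0 : f`_0 = 0.
Hypothesis f_abs_sum : abs_sum f (L0 + eps / 3) <= 2 ^- (8 * j.+2).
Hypothesis f_itv : forall x, `|x| <= L1 -> 0 <= f.[x] <= 1.
Hypothesis f_step : forall x, L0 + 2 * eps / 3 <= `|x| -> `|x| <= L1 -> 2^-1 <= f.[x].
Hypothesis f_abs_sum2 : abs_sum f (2 * L1) <= 2 ^+ b.
Hypothesis r_ge : (j.+1 + b <= r)%N.
Hypothesis MM_bounded : bounded_model L0 L1 MM.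
Hypothesis MM_expansion : has_expansion L0 L1 MM r c.
Hypothesis c_growth : forall i, (i < j)%N -> of_growth L0 (c i).
Hypothesis cj_large : large_part L0 (c j) S p.

Let L1_gt0 : 0 < L1. Proof. by move: L0_gt0 eps_gt0 L0_eps_le; lra. Qed.

Definition weighted n (G : {poly R}) := f ^+ scale n * G.

Definition weighted_trace n G : R :=
  linear_stat (model_space MM n) (fun z => complex.Re (toC (weighted n G)).[z]).

Definition main_term n G : R[i] :=
  \sum_(l <- S) pairing (pexp (p l) l) (toC (weighted n G)).

Lemma sum_bound (T : eqType) (s : seq T) (h : T -> nat -> R) (B : nat -> R) :
  (forall i, i \in s -> exists2 A, 0 <= A & forall n, (0 < n)%N -> h i n <= A * B n) ->
  exists2 A, 0 <= A & forall n, (0 < n)%N -> \sum_(i <- s) h i n <= A * B n.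
Proof.
elim: s => [|i s IH] hs; first by exists 0 => // n _; rewrite big_nil mul0r.
have [A A0 HA] := IH (fun k ks => hs k (mem_behead (s := i :: s) ks)).
have [A' A'0 HA'] := hs i (mem_head _ _).
exists (A' + A); first exact: addr_ge0.
by move=> n n0; rewrite big_cons mulrDl lerD ?HA ?HA'.
Qed.

(** The bound for [f], raised to the power [scale n], is [X ^ - (8 (j + 2)) <= n ^ - (j + 2)]:
    beyond order [n ^ - j], one factor pays for the [n] eigenvalues and one is gained. The radius
    exceeds [L0] so that sequences of growth [L0] are covered as well. *)
Lemma weighted_abs_sum_le G : exists2 A, 0 <= A & forall n, (0 < n)%N ->
  abs_sum (weighted n G) (L0 + eps / 3) <= A * n%:R ^- j.+2.
Proof.
have r0 : 0 <= L0 + eps / 3 by move: L0_gt0 eps_gt0; lra.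
exists (abs_sum G (L0 + eps / 3)); first exact: abs_sum_ge0.
move=> n n0; rewrite (le_trans (ler_abs_sumM _ _ r0)) // mulrC.
rewrite ler_wpM2l ?abs_sum_ge0 // (le_trans (ler_abs_sumX _ _ r0)) //.
apply: (@le_trans _ _ ((2 ^- (8 * j.+2)) ^+ scale n)).
  by rewrite lerXn2r ?nnegrE ?abs_sum_ge0 // invr_ge0 exprn_ge0.
rewrite -exprVn -exprM mulnC mulnA [(_ * 8)%N]mulnC exprM exprVn.
rewrite -[(n%:R ^+ _)^-1]exprVn lerXn2r ?nnegrE ?invr_ge0 ?exprn_ge0 ?ler0n //.
rewrite lef_pV2 ?posrE ?exprn_gt0 ?ltr0n //.
by rewrite -natrX ler_nat leq_scale_expn.
Qed.

(** [scale n] is a successor, so a factor [f] is always present. *)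
Lemma weighted_coef0 n G : (weighted n G)`_0 = 0.
Proof. by rewrite /weighted /scale exprS !coef0M f_coef0 !mul0r. Qed.

Lemma growth_pairing_le g G : of_growth L0 g ->
  exists2 A, 0 <= A & forall n, (0 < n)%N ->
    normc (pairing g (toC (weighted n G))) <= A * n%:R ^- j.+2.
Proof.
move=> gg; have e3 : 0 < eps / 3 by rewrite divr_gt0.
have [A A0 HA] := of_growth_bound L0_gt0 gg e3.
have [B B0 HB] := weighted_abs_sum_le G.
exists (A * B) => [|n n0]; first exact: mulr_ge0.
rewrite (le_trans (normc_pairing_le (weighted_coef0 n G) (fun k _ => HA k))) //.
by rewrite -mulrA ler_wpM2l // HB.
Qed.

Lemma pexp_pairing_le (q : {poly R[i]}) l G : normc (toC f).[l] <= 1 ->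
  exists2 A, 0 <= A & forall n, (0 < n)%N ->
    normc (pairing (pexp q l) (toC (weighted n G))) <= A * X n.
Proof.
move=> fl; have [d Hd] := pairing_pexp_pow_le fl q.
have [A A0 HA] := Hd (toC G).
have [B B0 HB] := @succn_pow_le_expr R d 2 (ltr1n _ 2).
exists (A * B) => [|n _]; first exact: mulr_ge0.
by rewrite rmorphM rmorphXn (le_trans (HA _)) // -mulrA ler_wpM2l.
Qed.

Lemma exppoly_pairing_le S' p' G : (forall l, l \in S' -> normc (toC f).[l] <= 1) ->
  exists2 A, 0 <= A & forall n, (0 < n)%N ->
    normc (pairing (exppoly S' p') (toC (weighted n G))) <= A * X n.
Proof.
move=> fS.
have [A A0 HA] := @sum_bound _ S'
  (fun l n => normc (pairing (pexp (p' l) l) (toC (weighted n G)))) X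
  (fun l lS => pexp_pairing_le (p' l) G (fS l lS)).
exists A => // n n0; apply: le_trans (HA n n0).
by rewrite /exppoly pairing_suml ler_normc_sum.
Qed.

Lemma normc_step_base l : cinterval (- L1) L1 l -> normc (toC f).[l] <= 1.
Proof.
case=> x /=; rewrite in_itv /= -ler_norml => /f_itv/andP[f0 f1] <-.
by rewrite horner_map normc_real ger0_norm.
Qed.

(** For [i < j] there are no larger bases and the pairing is already [O(n ^ - (j + 2))]; for [i > j]
    the bases cost [X], but division by [n ^ i] supplies [n ^ - (j + 1)]; for [i = j] the bases are
    exactly what is subtracted. *)
Lemma weighted_trace_remainder i G : (i < r)%N ->
  exists2 A, 0 <= A & forall n, (0 < n)%N ->
    normc (pairing (c i) (toC (weighted n G)) / n%:R ^+ i
           - (if i == j then main_term n G / n%:R ^+ j else 0))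
    <= A * (X n / n%:R ^+ j.+1).
Proof.
move=> ir.
have key g e : (forall n, 0 <= e n) -> of_growth L0 g -> (forall n, (0 < n)%N -> e n <= 1) ->
    exists2 A, 0 <= A & forall n, (0 < n)%N ->
      normc (pairing g (toC (weighted n G))) * e n <= A * (X n / n%:R ^+ j.+1).
  move=> e0 /growth_pairing_le-/(_ G) [A A0 HA] e1; exists A => // n n0.
  rewrite -[A in leRHS]mulr1 -mulrA.
  have nR : 1 <= n%:R :> R by rewrite ler1n.
  apply: (@le_trans _ _ (A * n%:R ^- j.+2)).
    by rewrite -[leRHS]mulr1 ler_pM ?normc_ge0 ?HA ?e1.
  rewrite ler_wpM2l // mul1r mulrC -[leLHS]mulr1 ler_pM ?invr_ge0 ?exprn_ge0 ?ler0n ?scaleX_ge1 //.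
  by rewrite lef_pV2 ?posrE ?exprn_gt0 ?ltr0n // ler_weXn2l.
have ni n k : (0 < n)%N -> 0 <= (normc (n%:R ^+ k : R[i]))^-1 <= 1.
  move=> n0; rewrite normcX normc_natr invr_ge0 exprn_ge0 ?ler0n //=.
  by rewrite invf_le1 ?exprn_gt0 ?ltr0n // exprn_ege1 // ler1n.
have e0 k n : 0 <= (normc (n%:R ^+ k : R[i]))^-1 by rewrite invr_ge0 normc_ge0.
have e1 k n : (0 < n)%N -> (normc (n%:R ^+ k : R[i]))^-1 <= 1.
  by move=> n0; have /andP[] := ni n k n0.
have [ij|ji|ij] := ltngtP i j.
- have [A A0 HA] := key (c i) (fun n => (normc (n%:R ^+ i : R[i]))^-1) (e0 i) (c_growth ij) (e1 i).
  by exists A => // n n0; rewrite subr0 Normc.normcM Normc.normcV HA.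
- have [_ _ /(_ i ir)[/(large_part_exists L0_gt0)[S' [p' Hp']] Lc]] := MM_expansion.
  rewrite (larger_bases_large L0_gt0 Hp') in Lc; have [_ _ gi] := Hp'.
  have [A A0 HA] := key _ (fun n => (normc (n%:R ^+ i : R[i]))^-1) (e0 i) gi (e1 i).
  have [B B0 HB] := exppoly_pairing_le p' G (fun l lS => normc_step_base (Lc l lS)).
  exists (A + B) => [|n n0]; first exact: addr_ge0.
  rewrite subr0 (_ : pairing (c i) _ = pairing (fun k => c i k - exppoly S' p' k) (toC (weighted n G))
    + pairing (exppoly S' p') (toC (weighted n G))); last first.
    by rewrite -pairingDl; apply: eq_bigr => k _; rewrite subrK.
  rewrite mulrDl (le_trans (ler_normcD _ _)) // mulrDl lerD //.
    by rewrite Normc.normcM Normc.normcV HA.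
  rewrite Normc.normcM Normc.normcV mulrA ler_pM ?normc_ge0 ?HB //.
  rewrite normcX normc_natr lef_pV2 ?posrE ?exprn_gt0 ?ltr0n //.
  by rewrite ler_weXn2l // ler1n.
- have [_ _ gj] := cj_large.
  have [A A0 HA] := key _ (fun n => (normc (n%:R ^+ j : R[i]))^-1) (e0 j) gj (e1 j).
  exists A => // n n0; rewrite ij -mulrBl Normc.normcM Normc.normcV.
  rewrite (_ : _ - main_term n G = pairing (fun k => c j k - exppoly S p k) (toC (weighted n G))).
    exact: HA.
  rewrite /main_term -pairing_suml -/(exppoly S p).
  apply/eqP; rewrite subr_eq -pairingDl; apply/eqP/eq_bigr => k _.
  by rewrite subrK.
Qed.

Lemma size_weighted n G : (size (weighted n G) <= size f * scale n + size G + 1)%N.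
Proof.
rewrite /weighted (leq_trans (size_polyMleq _ _)) // (leq_trans (leq_pred _)) //.
rewrite addnAC leq_add2r (leq_trans (size_poly_exp_leq _ _)) //.
by rewrite addn1 ltnS leq_mul2r leq_pred orbT.
Qed.

Lemma near_model (P : nat -> Prop) :
  (\forall n \near \oo, P n) -> \forall n \near F, P n.
Proof. by move=> PN; apply: cvg_within PN. Qed.

Lemma near_model_dims : \forall n \near F, model_dims MM n.
Proof. exact: withinT. Qed.

(** The growth of [K n / ln n] enters here: it lets the degree of a test polynomial, affine in
    [scale n], stay within the range of the expansion. *)
Lemma near_scale_leq (K : nat -> nat) a d :
  (K n)%:R / ln (n%:R : R) @[n --> F] --> +oo ->
  \forall n \near F, (a * scale n + d <= K n)%N.
Proof.
move=> /cvgryPge /(_ ((a + d)%:R / (4 * ln 2))).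
have ln2 : 0 < ln 2 :> R by rewrite ln_gt0 // ltr1n.
have := near_model (near_scale 2); apply: filterS2 => n s2 Kn.
have ls := scale_ln R s2.
have lsn : 0 < (scale n)%:R * (4 * ln 2) :> R.
  by rewrite !mulr_gt0 // ?ltr0n.
have lnn : 0 < ln n%:R :> R by apply: lt_le_trans ls.
rewrite ler_pdivlMr // in Kn.
have : (a + d)%:R * (scale n)%:R <= (K n)%:R :> R.
  apply: le_trans Kn; rewrite mulrAC ler_pdivlMr ?mulr_gt0 //.
  by rewrite -mulrA ler_wpM2l ?ler0n.
rewrite -natrM ler_nat; apply: leq_trans.
by rewrite mulnDl leq_add2l leq_pmulr.
Qed.

(** The radius [2 * L1] comes from growth [L1] used with excess [L1]. The power [f ^ scale n] costs
    at most [X ^ b <= (256 n) ^ b] in the norm, and the [b] additional orders of the expansion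
    absorb it. *)
Lemma expansion_error_le (A B : R) G (n : nat) : (0 < n)%N -> 0 <= A ->
  0 <= B -> A * B / n%:R ^+ r * abs_sum (weighted n G) (2 * L1)
  <= A * B * kappa ^+ b * abs_sum G (2 * L1) * (X n / n%:R ^+ j.+1).
Proof.
move=> n0 A0 B0; have L2 : 0 <= 2 * L1 by rewrite mulr_ge0 // ltW.
have nR : 1 <= n%:R :> R by rewrite ler1n.
have n_gt0 : 0 < n%:R :> R by rewrite ltr0n.
have X1 := scaleX_ge1 R n.
have W : abs_sum (weighted n G) (2 * L1) <= kappa ^+ b * n%:R ^+ b * abs_sum G (2 * L1).
  rewrite (le_trans (ler_abs_sumM _ _ L2)) // ler_wpM2r ?abs_sum_ge0 //.
  rewrite (le_trans (ler_abs_sumX _ _ L2)) //.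
  apply: (@le_trans _ _ ((2 ^+ b) ^+ scale n)).
    by rewrite lerXn2r ?nnegrE ?abs_sum_ge0 // exprn_ge0.
  rewrite -exprM mulnC exprM -/(X n) -exprMn.
  apply: (@le_trans _ _ ((X n ^+ 8) ^+ b)).
    by rewrite -[leRHS]exprM ler_weXn2l // leq_pmull.
  apply: lerXn2r; rewrite ?nnegrE; last exact: scaleX_le.
    by rewrite exprn_ge0 // (le_trans _ X1).
  by rewrite mulr_ge0.
apply: (@le_trans _ _ (A * B / n%:R ^+ r * (kappa ^+ b * n%:R ^+ b * abs_sum G (2 * L1)))).
  by rewrite ler_wpM2l // !mulr_ge0 // invr_ge0 exprn_ge0 // ltW.
have -> : A * B / n%:R ^+ r * (kappa ^+ b * n%:R ^+ b * abs_sum G (2 * L1)) =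
  A * B * kappa ^+ b * abs_sum G (2 * L1) * (n%:R ^+ b / n%:R ^+ r) by ring.
rewrite ler_wpM2l ?mulr_ge0 ?exprn_ge0 ?abs_sum_ge0 //.
rewrite ler_pdivrMr ?exprn_gt0 // mulrAC ler_pdivlMr ?exprn_gt0 // -exprD.
apply: (@le_trans _ _ (n%:R ^+ r)); first by rewrite ler_weXn2l // addnC.
by rewrite ler_peMl // exprn_ge0 // ltW.
Qed.

Lemma weighted_trace_asymp G : exists2 A, 0 <= A & \forall n \near F,
  normc ((weighted_trace n G)%:C - main_term n G / n%:R ^+ j)
  <= A * (X n / n%:R ^+ j.+1).
Proof.
have [[K [_ Kcvg [A0 HA0]]] cr _] := MM_expansion.
have [B B0 HB] := of_growth_bound L1_gt0 cr L1_gt0.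
have [B1 B10 HB1] := @sum_bound _ (index_enum 'I_r)
  (fun i n => normc (pairing (c i) (toC (weighted n G)) / n%:R ^+ i
           - (if i == j :> nat then main_term n G / n%:R ^+ j else 0)))
  (fun n => X n / n%:R ^+ j.+1)
  (fun i _ => weighted_trace_remainder G (ltn_ord i)).
pose C := `|A0| * B * kappa ^+ b * abs_sum G (2 * L1).
have L2 : 0 <= 2 * L1 by rewrite mulr_ge0 // ltW.
exists (C + B1).
  by rewrite addr_ge0 // /C !mulr_ge0 ?exprn_ge0 ?abs_sum_ge0.
have Ks := near_scale_leq (size f) (size G + 1) Kcvg.
have := near_model_dims; apply: filterS2 Ks => n Kn nd.
have n0 := model_dims_gt0 nd.
pose u k : R[i] := (expectation_mx (model_space MM n) (fun M => \tr (M ^+ k)))%:C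
  - \sum_(i < r) c i k / n%:R ^+ i.
set W := weighted n G.
(* Only the moments [1 <= k <= K n] enter: [W] has no constant term, and its degree is at most
   [K n]. *)
have uW : normc (pairing u (toC W)) <= C * (X n / n%:R ^+ j.+1).
  apply: (le_trans _ (expansion_error_le G n0 (normr_ge0 A0) B0)).
  apply: normc_pairing_le (weighted_coef0 n G) _ => k /andP[k0 kW].
  have kK : (1 <= k <= K n)%N.
    rewrite k0 /= (leq_trans (ltnW kW)) //; apply: leq_trans Kn.
    by rewrite addnA size_weighted.
  apply: (le_trans (HA0 n nd k kK)).
  rewrite [leRHS]mulrAC ler_wpM2r ?invr_ge0 ?exprn_ge0 ?ler0n //.
  apply: (@le_trans _ _ (`|A0| * normc (c r k))).
    by rewrite ler_wpM2r ?normc_ge0 ?ler_norm.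
  by rewrite -mulrA ler_wpM2l // (le_trans (HB k)) // mulr2n mulrDl !mul1r.
have rj : (j < r)%N by apply: leq_trans r_ge; rewrite addSn ltnS leq_addr.
have E : (weighted_trace n G)%:C - main_term n G / n%:R ^+ j = pairing u (toC W) +
    \sum_(i < r) (pairing (c i) (toC W) / n%:R ^+ i
      - (if i == j :> nat then main_term n G / n%:R ^+ j else 0)).
  rewrite sumrB -big_mkcond (big_pred1 (Ordinal rj)) //= /weighted_trace -pairing_trace.
  rewrite addrA; congr (_ - _).
  rewrite (_ : \sum_(i < r) _ = pairing (fun k => \sum_(i < r) c i k / n%:R ^+ i) (toC W)).
    by rewrite -pairingDl; apply: eq_bigr => k _; rewrite subrK.
  rewrite pairing_suml; apply: eq_bigr => i _.
  by rewrite mulrC -pairingZl; apply: eq_bigr => k _; rewrite [X in _ = _ * X]mulrC.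
rewrite E (le_trans (ler_normcD _ _)) // mulrDl lerD //.
by rewrite (le_trans (ler_normc_sum _ _ _)) // HB1.
Qed.

Lemma near_model_false : ~ (\forall n \near F, False).
Proof.
case=> N _ HN; apply: (@model_dims_infinite _ MM); apply: sub_finite_set (finite_II N).
move=> n nd /=; rewrite ltnNge; apply/negP => Nn; exact: HN n Nn nd.
Qed.

Lemma weighted_disk_le G : exists2 A, 0 <= A & forall n, (0 < n)%N ->
  forall z, cdisk L0 0 z -> `|complex.Re (toC (weighted n G)).[z]| <= A * n%:R ^- j.+2.
Proof.
have [A A0 HA] := weighted_abs_sum_le G; exists A => // n n0 z; rewrite /cdisk /= subr0 => zL.
apply: le_trans (HA n n0); apply: le_trans (normc_ge_absRe _) _.
apply: normc_horner_le; apply: le_trans zL _.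
by rewrite lerDl divr_ge0 // ltW.
Qed.

Lemma Re_horner_real (Q : {poly R}) x : complex.Re (toC Q).[x%:C] = Q.[x].
Proof. by rewrite horner_map. Qed.

Lemma real_or_disk z : (cdisk L0 0 `|` cinterval (- L1) L1) z ->
  (exists2 x, z = x%:C & `|x| <= L1) \/ cdisk L0 0 z.
Proof.
case=> [|[x]]; first by right.
by rewrite /= in_itv /= -ler_norml => xL <-; left; exists x.
Qed.

Lemma ler_model_stat n (phi psi : R[i] -> R) : model_dims MM n ->
  (forall x, `|x| <= L1 -> phi x%:C <= psi x%:C) ->
  (forall z, cdisk L0 0 z -> phi z <= psi z) ->
  linear_stat (model_space MM n) phi <= linear_stat (model_space MM n) psi.
Proof.
move=> nd hr hd; apply: ler_linear_stat => M z Matom zM.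
by have [[x -> xL]|zd] := real_or_disk (MM_bounded nd Matom zM);
  [exact: hr | exact: hd].
Qed.

(** * Polynomials that annihilate bases *)

Definition real_bases : seq R := [seq complex.Re l | l <- S].

Hypothesis S_real : [set` S] `<=` cinterval (- L1) L1.

Lemma S_Re l : l \in S -> l = (complex.Re l)%:C /\ `|complex.Re l| <= L1.
Proof. by move=> /S_real[x]; rewrite /= in_itv /= -ler_norml => xL <-. Qed.

Lemma mem_real_bases y : (y \in real_bases) = (y%:C \in S).
Proof.
apply/mapP/idP => [[l lS ->]|yS]; first by have [<-] := S_Re lS.
by exists y%:C.
Qed.

Lemma uniq_real_bases : uniq real_bases.
Proof.
rewrite map_inj_in_uniq ?fset_uniq // => l l' /S_Re[-> _] /S_Re[-> _] /=.
by move=> ->.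
Qed.

Lemma main_term_single n G y :
  (forall l, l \in S -> l != y%:C -> ('X - l%:P) ^+ size (p l) %| toC G) ->
  main_term n G = pairing (pexp (extend0 S p y%:C) y%:C) (toC (weighted n G)).
Proof.
move=> dvd; have z0 l : l \in S -> l != y%:C ->
    pairing (pexp (p l) l) (toC (weighted n G)) = 0.
  move=> lS ly; have /dvdpP[Q GQ] := dvd l lS ly.
  by rewrite rmorphM /= GQ mulrA mulrC pairing_pexp_eq0.
rewrite /main_term /extend0; case: ifPn => [yS|yS].
  rewrite (big_fsetD1 _ yS) /= big1_seq ?addr0 // => l /andP[_].
  by rewrite in_fsetD1 => /andP[ly lS]; apply: z0.
rewrite -polyC0 pairing_pexpC mul0r big1_seq // => l /andP[_ lS].
by apply: z0 => //; apply: contraNneq yS => <-.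
Qed.

Lemma main_term_eq0 n G :
  (forall l, l \in S -> ('X - l%:P) ^+ size (p l) %| toC G) -> main_term n G = 0.
Proof.
move=> dvd; rewrite /main_term big1_seq // => l /andP[_ lS].
have /dvdpP[Q GQ] := dvd l lS.
by rewrite rmorphM /= GQ mulrA mulrC pairing_pexp_eq0.
Qed.

(** Exponents are doubled to make the polynomial nonnegative on the real line, so that contributions
    of real eigenvalues cannot cancel. *)
Definition killer (e : R -> nat) : {poly R} :=
  \prod_(y <- real_bases) ('X - y%:P) ^+ (2 * e y).

Lemma hornerE_killer e x :
  (killer e).[x] = \prod_(y <- real_bases) (`|x - y| ^+ e y) ^+ 2.
Proof.
rewrite horner_prod; apply: eq_bigr => y _.
rewrite horner_exp hornerXsubC exprM -(real_normK (num_real (x - y))) -!exprM.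
by rewrite mulnC.
Qed.

Lemma killer_ge0 e x : 0 <= (killer e).[x].
Proof. by rewrite hornerE_killer prodr_ge0 // => y _; rewrite sqr_ge0. Qed.

Lemma killer_dvd e l : l \in S -> (size (p l) <= 2 * e (complex.Re l))%N ->
  ('X - l%:P) ^+ size (p l) %| toC (killer e).
Proof.
move=> lS le; rewrite /killer rmorph_prod /= (big_map (@complex.Re R) xpredT).
have lR := (S_Re lS).1.
rewrite (big_fsetD1 _ lS) /= rmorphXn /= map_polyXsubC /= -lR.
by rewrite dvdp_mulr // dvdp_exp2l.
Qed.

Definition total_size : nat := (\sum_(l <- S) size (p l))%N.

Lemma size_le_total l : l \in S -> (size (p l) <= total_size)%N.
Proof. by move=> lS; rewrite /total_size (big_fsetD1 _ lS) leq_addr. Qed.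

Definition killer_but (y : R) : {poly R} :=
  killer (fun y' => if y' == y then 0 else total_size)%N.

Lemma killer_but_gt0 y : 0 < (killer_but y).[y].
Proof.
rewrite hornerE_killer prodr_gt0 // => y' _; rewrite exprn_gt0 //.
case: (eqVneq y' y) => [|yy']; first by rewrite expr0.
by rewrite exprn_gt0 // normr_gt0 subr_eq0 eq_sym.
Qed.

Lemma killer_but_dvd y l : l \in S -> l != y%:C ->
  ('X - l%:P) ^+ size (p l) %| toC (killer_but y).
Proof.
move=> lS ly; apply: killer_dvd => //; case: eqVneq => [E|_].
  by move: ly; rewrite -E -(S_Re lS).1 eqxx.
by rewrite (leq_trans (size_le_total lS)) // leq_pmull.
Qed.

Lemma step_pow_ge y n : L0 + 2 * eps / 3 <= `|y| -> `|y| <= L1 ->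
  (X n)^-1 <= f.[y] ^+ scale n.
Proof.
move=> yL yL1; have h := f_step yL yL1.
rewrite /scaleX -exprVn lerXn2r ?nnegrE ?invr_ge0 //.
by have /andP[] := f_itv yL1.
Qed.

Lemma weighted_ge0 n G x : `|x| <= L1 -> 0 <= G.[x] -> 0 <= (weighted n G).[x].
Proof.
by move=> /f_itv/andP[f0 _] G0; rewrite hornerM horner_exp mulr_ge0 // exprn_ge0.
Qed.

Lemma normc_step_real y : `|y| <= L1 -> normc (toC f).[y%:C] <= 1.
Proof.
by move=> yL; apply: normc_step_base; exists y; rewrite //= in_itv /= -ler_norml.
Qed.

(** * Constancy of the coefficients at large bases *)

Lemma amgm (R' : realFieldType) (t s : R') : 0 < t -> `|s| <= t * s ^+ 2 + t^-1.
Proof.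
move=> t0; have tt : t * t^-1 = 1 by rewrite mulfV // gt_eqF.
have ti : 0 < t^-1 by rewrite invr_gt0.
suff : 2 * `|s| <= t * s ^+ 2 + t^-1 by have := normr_ge0 s; lra.
have := sqr_ge0 (t * `|s| - 1); rewrite -(real_normK (num_real s)).
move: (`|s|) (normr_ge0 s) => u u0 h.
suff : 0 <= t^-1 * (t * u - 1) ^+ 2.
  suff -> : t^-1 * (t * u - 1) ^+ 2 = t * u ^+ 2 + t^-1 - 2 * u by lra.
  by field; rewrite gt_eqF.
by rewrite mulr_ge0 // ltW.
Qed.

Lemma weighted_traceE n G : weighted_trace n G =
  linear_stat (model_space MM n) (fun z => complex.Re (toC (weighted n G)).[z]).
Proof. by []. Qed.

Lemma scaled_trace_asymp G : exists2 A, 0 <= A & \forall n \near F,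
  normc ((weighted_trace n G * n%:R ^+ j)%:C - main_term n G) <= A * X n / n%:R.
Proof.
have [A A0 HA] := weighted_trace_asymp G; exists A => //.
have := near_model_dims; apply: filterS2 HA => n HA /model_dims_gt0 n0.
have v0 : 0 < n%:R ^+ j :> R by rewrite exprn_gt0 // ltr0n.
have vC : n%:R ^+ j = (n%:R ^+ j)%:C :> R[i] by rewrite rmorphXn rmorph_nat.
have v0C : n%:R ^+ j != 0 :> R[i] by rewrite vC -normc_gt0 normc_real normr_gt0 gt_eqF.
rewrite -(ler_pM2r v0) in HA.
rewrite (_ : A * X n / n%:R = A * (X n / n%:R ^+ j.+1) * n%:R ^+ j); last first.
  by rewrite exprS; field; rewrite ?gt_eqF ?ltr0n.
apply: le_trans HA; rewrite [X in _ <= _ * X](_ : _ = normc (n%:R ^+ j : R[i])).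
  have -> : (weighted_trace n G * n%:R ^+ j)%:C = (weighted_trace n G)%:C * n%:R ^+ j.
    by rewrite vC -rmorphM.
  by rewrite -Normc.normcM mulrBl mulfVK.
by rewrite vC normc_real ger0_norm // ltW.
Qed.

Lemma scaled_slack (B : R) n : (0 < n)%N ->
  n%:R * (B * n%:R ^- j.+2) * n%:R ^+ j = B / n%:R.
Proof.
move=> n0; have N0 : n%:R != 0 :> R by rewrite pnatr_eq0 -lt0n.
by rewrite !exprS; field; rewrite ?expf_neq0 ?N0.
Qed.

Lemma exprn_div_le (x N : R) k : 1 <= x -> 0 < N -> x ^+ 8 <= kappa * N -> (k <= 8)%N ->
  x ^+ k / N <= kappa.
Proof.
by move=> x1 N0 xN k8; rewrite ler_pdivrMr // (le_trans _ xN) // ler_weXn2l.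
Qed.

(** After scaling by [n ^ j], the trace for [Gd] has a main term of at least a multiple of [1 / X],
    that for [G0] is [O(X)], and that for [G2], whose main term is annihilated, is [O(X / n)]. With
    [t = X ^ 4] this would give [1 / X = O(X ^ 5 / n + X ^ -3)], impossible for large [X] because
    [n] is of order [X ^ 8]. *)
Lemma base_coef_const y : y%:C \in S -> L0 + 2 * eps / 3 <= `|y| ->
  (size (p y%:C) <= 1)%N.
Proof.
move=> yS yL; rewrite leqNgt; apply/negP => sp.
have yL1 : `|y| <= L1 by have [_] := S_Re yS.
have [d sd] : exists d, size (p y%:C) = d.+2.
  by exists (size (p y%:C)).-2; case: (size _) sp => [|[|]].
have [a a0 Ha] := pairing_pexp_lead y%:C sd.
have y0 : y%:C != 0.
  rewrite -normc_gt0 normc_real; apply: lt_le_trans yL.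
  by move: L0_gt0 eps_gt0; lra.
(* [k] is the degree of the coefficient: [k] factors leave a nonzero constant, and [2 * k] factors
   annihilate it because [k > 0]. *)
pose k := d.+1; pose G0 := killer_but y.
pose Gd := ('X - y%:P) ^+ k * G0; pose G2 := ('X - y%:P) ^+ (2 * k) * G0.
have dvdX (e : nat) l : l \in S -> l != y%:C ->
    ('X - l%:P) ^+ size (p l) %| toC (('X - y%:P) ^+ e * G0).
  by move=> lS ly; rewrite rmorphM /= dvdp_mull // killer_but_dvd.
have ext : extend0 S p y%:C = p y%:C by rewrite /extend0 yS.
pose al := normc (a * y%:C ^+ k) * G0.[y].
have al0 : 0 < al.
  by rewrite mulr_gt0 ?killer_but_gt0 // normc_gt0 mulf_neq0 // expf_neq0.
have main_d n : normc (main_term n Gd) = al * f.[y] ^+ scale n.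
  rewrite (main_term_single _ (dvdX k)) ext.
  rewrite (_ : toC _ = ('X - (y%:C)%:P) ^+ k * toC (weighted n G0)); last first.
    by rewrite /weighted /Gd !rmorphM !rmorphXn /= map_polyXsubC mulrCA.
  rewrite Ha horner_map /= Normc.normcM normc_real hornerM horner_exp.
  rewrite ger0_norm ?mulr_ge0 ?exprn_ge0 ?(ltW (killer_but_gt0 y)) //.
    by rewrite /al; ring.
  by have /andP[] := f_itv yL1.
have main_2 n : main_term n G2 = 0.
  apply: main_term_eq0 => l lS; have [->|ly] := eqVneq l y%:C; last exact: dvdX.
  rewrite /G2 rmorphM rmorphXn /= map_polyXsubC dvdp_mulr // dvdp_exp2l // sd.
  by rewrite mul2n -addnn /k addSn ltnS leq_addl.
have [A0 A00 HA0] := scaled_trace_asymp G0.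
have [Ad Ad0 HAd] := scaled_trace_asymp Gd.
have [A2 A20 HA2] := scaled_trace_asymp G2.
have [B0 B00 HB0] := weighted_disk_le G0.
have [Bd Bd0 HBd] := weighted_disk_le Gd.
have [B2 B20 HB2] := weighted_disk_le G2.
have [M M0 HM] := pexp_pairing_le (p y%:C) G0 (normc_step_real yL1).
pose C := kappa * (A2 + A0 + Ad + B0 + Bd + B2) + M.
apply: near_model_false; near=> n.
have nd : model_dims MM n by near: n; exact: near_model_dims.
have n0 := model_dims_gt0 nd.
have Xn : C / al + 1 <= X n by near: n; apply: near_model; exact: near_scaleX.
have hA0 : normc ((weighted_trace n G0 * n%:R ^+ j)%:C - main_term n G0) <= A0 * X n / n%:R.
  by near: n; exact: HA0.
have hAd : normc ((weighted_trace n Gd * n%:R ^+ j)%:C - main_term n Gd) <= Ad * X n / n%:R.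
  by near: n; exact: HAd.
have hA2 : normc ((weighted_trace n G2 * n%:R ^+ j)%:C - main_term n G2) <= A2 * X n / n%:R.
  by near: n; exact: HA2.
have x1 := scaleX_ge1 R n; have x0 := scaleX_gt0 R n; have xN := scaleX_le R n0.
have N0 : 0 < n%:R :> R by rewrite ltr0n.
have v0 : 0 < n%:R ^+ j :> R by rewrite exprn_gt0.
pose t := X n ^+ 4; have t0 : 0 < t by rewrite exprn_gt0.
have ti0 : 0 < t^-1 by rewrite invr_gt0.
pose sl := (Bd + t * B2 + t^-1 * B0) * n%:R ^- j.+2.
(* [s] is a sign. At real eigenvalues this is [|w| <= t w ^ 2 + 1 / t] for [w = (x - y) ^ k],
   weighted by the nonnegative [f ^ m * G0]; on the disk nothing has a sign, and the slack [sl] per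
   eigenvalue covers it. *)
have hstat s : `|s| = 1 -> s * weighted_trace n Gd <=
    t * weighted_trace n G2 + t^-1 * weighted_trace n G0 + n%:R * sl.
  move=> s1; rewrite !weighted_traceE -!linear_statZ -(@linear_stat_cst R n (model_space MM n)) -!linear_statD.
  apply: ler_model_stat => // [x xL|z zd]; last first.
    have h0 := HB0 n n0 z zd; have h2 := HB2 n n0 z zd; have hd := HBd n n0 z zd.
    have hs : s * complex.Re (toC (weighted n Gd)).[z] <= Bd * n%:R ^- j.+2.
      by rewrite (le_trans (ler_norm _)) // normrM s1 mul1r.
    have h2' : - (B2 * n%:R ^- j.+2) <= complex.Re (toC (weighted n G2)).[z].
      by have := h2; rewrite ler_norml => /andP[].
    have h0' : - (B0 * n%:R ^- j.+2) <= complex.Re (toC (weighted n G0)).[z].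
      by have := h0; rewrite ler_norml => /andP[].
    have := ler_wpM2l (ltW t0) h2'; have := ler_wpM2l (ltW ti0) h0'.
    rewrite /sl; move: (complex.Re _) (complex.Re _) (complex.Re _) hs => u1 u2 u3.
    by move: (n%:R ^- j.+2) t^-1 => w ti; nra.
  have sl0 : 0 <= sl.
    rewrite mulr_ge0 ?invr_ge0 ?exprn_ge0 ?ler0n //.
    by rewrite !addr_ge0 // mulr_ge0 // ltW.
  rewrite !Re_horner_real /Gd /G2 /weighted !hornerM !horner_exp !hornerXsubC.
  have u0 : 0 <= f.[x] ^+ scale n * G0.[x].
    by rewrite mulr_ge0 ?killer_ge0 // exprn_ge0 //; have /andP[] := f_itv xL.
  have := amgm ((x - y) ^+ k) t0; rewrite -exprM mulnC.
  have : s * (x - y) ^+ k <= `|(x - y) ^+ k|.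
    by rewrite (le_trans (ler_norm _)) // normrM s1 mul1r.
  move: ((x - y) ^+ k) ((x - y) ^+ (2 * k)) => w w2 h1 h2.
  have h3 := ler_wpM2r u0 (le_trans h1 h2).
  have -> : s * (f.[x] ^+ scale n * (w * G0.[x])) = s * w * (f.[x] ^+ scale n * G0.[x]) by ring.
  have -> : f.[x] ^+ scale n * (w2 * G0.[x]) = w2 * (f.[x] ^+ scale n * G0.[x]) by ring.
  by apply: (le_trans h3); rewrite mulrDl -mulrA lerDl.
have hTd : `|weighted_trace n Gd| <=
    t * weighted_trace n G2 + t^-1 * weighted_trace n G0 + n%:R * sl.
  rewrite ler_norml lerNl -mulN1r hstat ?normrN1 //=.
  by rewrite -[leLHS]mul1r hstat ?normr1.
have h2 : weighted_trace n G2 * n%:R ^+ j <= A2 * X n / n%:R.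
  apply: le_trans hA2; rewrite main_2 subr0 normc_real ler_norm //.
have h0 : weighted_trace n G0 * n%:R ^+ j <= M * X n + A0 * X n / n%:R.
  apply: (@le_trans _ _ (normc (weighted_trace n G0 * n%:R ^+ j)%:C)).
    by rewrite normc_real ler_norm.
  apply: (le_trans (ler_normcB _ (main_term n G0))); apply: lerD hA0.
  rewrite (@main_term_single n G0 y) ?ext ?HM // => l lS ly.
  exact: killer_but_dvd.
have hd : al / X n <= `|weighted_trace n Gd| * n%:R ^+ j + Ad * X n / n%:R.
  apply: (@le_trans _ _ (normc (main_term n Gd))).
    by rewrite main_d ler_wpM2l ?(ltW al0) // step_pow_ge.
  apply: (le_trans (ler_normcB _ (weighted_trace n Gd * n%:R ^+ j)%:C)).
  by rewrite normcBC lerD // normc_real normrM [X in _ * X]ger0_norm // ltW.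
have : `|weighted_trace n Gd| * n%:R ^+ j <= t * (A2 * X n / n%:R) +
    t^-1 * (M * X n + A0 * X n / n%:R) + (Bd + t * B2 + t^-1 * B0) / n%:R.
  apply: (le_trans (ler_wpM2r (ltW v0) hTd)).
  rewrite [leLHS]mulrDl [X in X + _ <= _]mulrDl -(mulrA t) -(mulrA t^-1) /sl.
  by rewrite scaled_slack // lerD2r lerD // ler_wpM2l // ltW.
move=> hT; have E k' : (k' <= 8)%N -> X n ^+ k' / n%:R <= kappa.
  exact: exprn_div_le.
have : al / X n * X n ^+ 3 <= C.
  apply: (@le_trans _ _ ((t * (A2 * X n / n%:R) + t^-1 * (M * X n + A0 * X n / n%:R) +
      (Bd + t * B2 + t^-1 * B0) / n%:R + Ad * X n / n%:R) * X n ^+ 3)).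
    by rewrite ler_wpM2r ?exprn_ge0 ?(ltW x0) // (le_trans hd) // lerD2r.
  have tx : t^-1 * X n ^+ 3 = (X n)^-1.
    by rewrite /t; field; rewrite gt_eqF.
  have xi : (X n)^-1 <= 1 by rewrite invf_le1.
  have xi0 : 0 <= (X n)^-1 by rewrite invr_ge0 ltW.
  have N1 : n%:R^-1 <= kappa :> R by have := E 0%N isT; rewrite mul1r.
  rewrite [leLHS](_ : _ = A2 * (X n ^+ 8 / n%:R) + M + A0 * n%:R^-1 +
    Bd * (X n ^+ 3 / n%:R) + B2 * (X n ^+ 7 / n%:R) + B0 * ((X n)^-1 * n%:R^-1)
    + Ad * (X n ^+ 4 / n%:R)); last first.
    by rewrite /t; field; rewrite !gt_eqF.
  have hx : (X n)^-1 * n%:R^-1 <= kappa.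
    by apply: le_trans N1; rewrite ler_piMl // invr_ge0 ltW.
  have := ler_wpM2l A20 (E 8%N isT); have := ler_wpM2l A00 N1.
  have := ler_wpM2l Bd0 (E 3%N isT); have := ler_wpM2l B20 (E 7%N isT).
  have := ler_wpM2l B00 hx; have := ler_wpM2l Ad0 (E 4%N isT).
  rewrite /C; lra.
rewrite (_ : al / X n * X n ^+ 3 = al * X n * X n); last by field; rewrite gt_eqF.
move=> h; have : al * X n <= C.
  by apply: le_trans h; rewrite ler_peMr // mulr_ge0 // ltW.
rewrite mulrC -ler_pdivlMr // => h'; lra.
Unshelve. all: by end_near. Qed.

(** * Counting eigenvalues near a base and away from all bases *)

Definition weight n y := f.[y] ^+ scale n * (killer_but y).[y].

Lemma weight_horner n y : (weighted n (killer_but y)).[y] = weight n y.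
Proof. by rewrite hornerM horner_exp. Qed.

Lemma killer_sq_ge0 y x : 0 <= (('X - y%:P) ^+ 2 * killer_but y).[x].
Proof. by rewrite hornerM horner_exp mulr_ge0 ?killer_ge0 // sqr_ge0. Qed.

(** Both factors are positive at [y], [f] being at least 1/2 there, so Lipschitz bounds become
    relative ones; these accumulate over [scale n + 1] factors. *)
Lemma weighted_near y : L0 + 2 * eps / 3 <= `|y| -> `|y| <= L1 ->
  exists2 A, 0 <= A & forall n d x, 0 <= d -> (scale n).+1%:R * d * A <= 2^-1 ->
    `|x| <= L1 -> `|x - y| <= d ->
    `|(weighted n (killer_but y)).[x] - weight n y| <=
      2 * ((scale n).+1%:R * d * A) * weight n y.
Proof.
move=> yL yL1; have fy := f_step yL yL1; have g0 := killer_but_gt0 y.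
have [A A0 HA] := poly_lipschitz f y L1.
have [B B0 HB] := poly_lipschitz (killer_but y) y L1.
have Bg : 0 <= B / (killer_but y).[y] by rewrite divr_ge0 // ltW.
exists (2 * A + B / (killer_but y).[y]); first by rewrite addr_ge0 // mulr_ge0.
move=> n d x d0; rewrite -!(mulrA (scale n).+1%:R d) => hd xL xd.
rewrite hornerM horner_exp /weight.
apply: product_close; rewrite ?(lt_le_trans _ fy) //.
- by rewrite mulr_ge0 // addr_ge0 // mulr_ge0.
- apply: (le_trans (HA x xL)); apply: (@le_trans _ _ (A * d)); first by rewrite ler_wpM2l.
  have h : A * d <= d * (2 * A) * f.[y].
    by have := mulr_ge0 A0 d0; nra.
  apply: (le_trans h); rewrite ler_wpM2r //; first by rewrite (le_trans _ fy).
  by rewrite ler_wpM2l // lerDl.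
- apply: (le_trans (HB x xL)); apply: (@le_trans _ _ (B * d)); first by rewrite ler_wpM2l.
  rewrite mulrDr mulrDl -[leLHS]add0r lerD //.
    by rewrite !mulr_ge0 // ltW.
  by rewrite -!mulrA mulVf ?gt_eqF // mulr1 mulrC.
Qed.

Lemma Ein_ge0 n (A : set R[i]) : 0 <= Ein (model_space MM n) A.
Proof.
rewrite EinE -[leLHS](mulr0 n%:R) -(@linear_stat_cst R n (model_space MM n)).
by apply: ler_linear_stat => M z _ _; rewrite ler0n.
Qed.

Lemma disk_far z y d : cdisk L0 0 z -> L0 + 2 * eps / 3 <= `|y| -> d <= eps / 3 ->
  z \in cdisk d y%:C = false.
Proof.
rewrite /cdisk /= subr0 => zL yL de; apply/negbTE/negP; rewrite inE /= => zd.
have := ler_normcB y%:C z; rewrite normc_real normcBC => h.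
by move: eps_gt0 L0_gt0 zL yL de zd h; lra.
Qed.

Lemma cdisk_real (d y x : R) : (x%:C \in cdisk d y%:C) = (`|x - y| <= d).
Proof. by rewrite -normc_real rmorphB; apply/idP/idP; rewrite inE. Qed.

(** Inside the ball the test polynomial is nearly its value at the centre; outside,
    [(x - y) ^ 2 / d ^ 2 >= 1], so the polynomial with the extra square dominates it. The term
    [B / n] accounts for the disk, which [d <= eps / 3] keeps disjoint from the ball. *)
Lemma Ein_sandwich y : L0 + 2 * eps / 3 <= `|y| -> `|y| <= L1 ->
  exists A B : R, [/\ 0 <= A, 0 <= B & forall n d, model_dims MM n -> 0 < d -> d <= eps / 3 ->
    d <= 1 -> (scale n).+1%:R * d * A <= 2^-1 ->
    let E := Ein (model_space MM n) (cdisk d y%:C) * n%:R ^+ j in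
    let W0 := weighted_trace n (killer_but y) * n%:R ^+ j in
    let W2 := weighted_trace n (('X - y%:P) ^+ 2 * killer_but y) * n%:R ^+ j in
    `|W0 - weight n y * E| <= 2 * ((scale n).+1%:R * d * A) * (weight n y * E)
      + (d ^-1) ^+ 2 * (W2 + B / n%:R)].
Proof.
move=> yL yL1; have [A A0 HA] := weighted_near yL yL1.
pose G0 := killer_but y; pose G2 := ('X - y%:P) ^+ 2 * G0.
have [B0 B00 HB0] := weighted_disk_le G0.
have [B2 B20 HB2] := weighted_disk_le G2.
exists A, (B0 + B2); split=> //; first exact: addr_ge0.
move=> n d nd d0 de d1 hd /=.
set tau := 2 * _; set w := weight n y.
have n0 := model_dims_gt0 nd.
have v0 : 0 < n%:R ^+ j :> R by rewrite exprn_gt0 // ltr0n.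
have D1 : 1 <= d^-1 ^+ 2 by rewrite exprn_ege1 // invf_ge1.
have tau0 : 0 <= tau by rewrite !mulr_ge0 // ltW.
have w0 : 0 <= w.
  rewrite /w /weight mulr_ge0 ?killer_ge0 // exprn_ge0 //.
  by have /andP[] := f_itv yL1.
pose sl := (B0 + B2) * n%:R ^- j.+2.
have Ni : 0 <= n%:R ^- j.+2 :> R by rewrite invr_ge0 exprn_ge0 ?ler0n.
have far x : ~~ (x%:C \in cdisk d y%:C) -> `|x| <= L1 ->
    (weighted n G0).[x] <= d^-1 ^+ 2 * (weighted n G2).[x].
  rewrite cdisk_real -ltNge => xd xL.
  have G00 := weighted_ge0 n xL (killer_ge0 _ x : 0 <= G0.[x]).
  have -> : (weighted n G2).[x] = (x - y) ^+ 2 * (weighted n G0).[x].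
    by rewrite /weighted /G2 !hornerM !horner_exp hornerXsubC; ring.
  rewrite mulrA ler_peMl // -exprMn -[X in _ <= X]real_normK ?num_real //.
  by rewrite exprn_ege1 // normrM ger0_norm ?invr_ge0 ?(ltW d0) // mulrC ler_pdivlMr // mul1r ltW.
have close x : x%:C \in cdisk d y%:C -> `|x| <= L1 ->
    `|(weighted n G0).[x] - w| <= tau * w.
  by rewrite cdisk_real => xd xL; apply: HA => //; apply: ltW.
have G20 x : `|x| <= L1 -> 0 <= (weighted n G2).[x].
  by move=> xL; apply: weighted_ge0 xL (killer_sq_ge0 y x).
have G00 x : `|x| <= L1 -> 0 <= (weighted n G0).[x].
  by move=> xL; apply: weighted_ge0 xL (killer_ge0 _ x).
have sl0 : 0 <= sl by rewrite mulr_ge0 // addr_ge0.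
have Dsl0 : 0 <= d^-1 ^+ 2 * sl by rewrite mulr_ge0 // (le_trans _ D1).
pose E1 := Ein (model_space MM n) (cdisk d y%:C).
have up : w * E1 + - 1 * weighted_trace n G0 <=
    tau * w * E1 + (d^-1 ^+ 2 * weighted_trace n G2 + n%:R * (d^-1 ^+ 2 * sl)).
  rewrite !weighted_traceE /E1 EinE -!linear_statZ.
  rewrite -(@linear_stat_cst R n (model_space MM n)) -!linear_statD.
  apply: ler_model_stat => // [x xL|z zd].
    rewrite !Re_horner_real; have g2 := G20 x xL; have g0 := G00 x xL.
    have D2 : 0 <= d^-1 ^+ 2 * (weighted n G2).[x] by rewrite mulr_ge0 // (le_trans _ D1).
    case: (boolP (x%:C \in cdisk d y%:C)) => [/close/(_ xL)|/far/(_ xL)] /= h; last by lra.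
    by move: h; rewrite !mulr1 ler_distl => /andP[h1 h2]; lra.
  have := HB0 n n0 z zd; rewrite ler_norml => /andP[h0 _].
  have := HB2 n n0 z zd; rewrite ler_norml => /andP[h2 _].
  have := ler_wpM2l (le_trans ler01 D1) h2.
  have := ler_wpM2r (mulr_ge0 B00 Ni) D1.
  rewrite (disk_far zd yL de) /= /sl !mulr0 !add0r mulN1r mul1r.
  by move: (complex.Re _) (complex.Re _) h0 => u1 u2; lra.
have lo : weighted_trace n G0 + - 1 * (w * E1) <=
    tau * w * E1 + (d^-1 ^+ 2 * weighted_trace n G2 + n%:R * (d^-1 ^+ 2 * sl)).
  rewrite !weighted_traceE /E1 EinE -!linear_statZ.
  rewrite -(@linear_stat_cst R n (model_space MM n)) -!linear_statD.
  apply: ler_model_stat => // [x xL|z zd].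
    rewrite !Re_horner_real; have g2 := G20 x xL; have g0 := G00 x xL.
    have D2 : 0 <= d^-1 ^+ 2 * (weighted n G2).[x] by rewrite mulr_ge0 // (le_trans _ D1).
    case: (boolP (x%:C \in cdisk d y%:C)) => [/close/(_ xL)|/far/(_ xL)] /= h; last by lra.
    by move: h; rewrite !mulr1 ler_distl => /andP[h1 h2]; lra.
  have := HB0 n n0 z zd; rewrite ler_norml => /andP[_ h0].
  have := HB2 n n0 z zd; rewrite ler_norml => /andP[h2 _].
  have := ler_wpM2l (le_trans ler01 D1) h2.
  have := ler_wpM2r (mulr_ge0 B00 Ni) D1.
  rewrite (disk_far zd yL de) /= /sl !mulr0 ?add0r ?addr0 ?mul1r.
  by move: (complex.Re _) (complex.Re _) h0 => u1 u2; lra.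
have sE : n%:R * (d^-1 ^+ 2 * sl) * n%:R ^+ j = d^-1 ^+ 2 * ((B0 + B2) / n%:R).
  by rewrite -scaled_slack // /sl; ring.
have := ler_wpM2r (ltW v0) up; have := ler_wpM2r (ltW v0) lo.
rewrite -/G0 -/G2 -/E1; move: (d^-1 ^+ 2) sE => D sE lo' up'.
rewrite ler_distl mulrDr -sE; apply/andP; split; [move: up'|move: lo'];
  move: (n%:R * (D * sl)) => u; lra.
Qed.
Lemma weight_ge n y : L0 + 2 * eps / 3 <= `|y| -> `|y| <= L1 ->
  (killer_but y).[y] / X n <= weight n y.
Proof.
by move=> yL yL1; rewrite /weight mulrC ler_wpM2r ?step_pow_ge // ltW // killer_but_gt0.
Qed.

(** The main terms of the two traces are [C * weight n y] and 0. Errors of order [X / n], magnified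
    by [X ^ 4] from the squared radius and by [X] on division by the weight, stay below a multiple
    of [1 / X]. *)
Lemma Ein_ball_asymp y (C : R[i]) th e :
  L0 + 2 * eps / 3 <= `|y| -> `|y| <= L1 -> extend0 S p y%:C = C%:P ->
  0 < th -> th <= 4^-1 -> 0 < e ->
  \forall n \near F, normc
    ((Ein (model_space MM n) (cdisk (n%:R `^ (- th)) y%:C) * n%:R ^+ j)%:C - C) <= e.
Proof.
move=> yL yL1 ext th0 th4 e0.
have [A [B [A0 B0 HAB]]] := Ein_sandwich yL yL1.
pose G0 := killer_but y; pose G2 := ('X - y%:P) ^+ 2 * G0.
have [A1 A10 HA1] := scaled_trace_asymp G0.
have [A2 A20 HA2] := scaled_trace_asymp G2.
have g0 := killer_but_gt0 y.
have main_0 n : main_term n G0 = C * (weight n y)%:C.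
  rewrite (@main_term_single n G0 y) => [|l lS ly]; last exact: killer_but_dvd.
  by rewrite ext pairing_pexpC horner_map weight_horner.
have main_2 n : main_term n G2 = 0.
  apply: main_term_eq0 => l lS; rewrite rmorphM rmorphXn /= map_polyXsubC.
  have [E|ly] := eqVneq l y%:C; last by rewrite dvdp_mull // killer_but_dvd.
  rewrite E dvdp_mulr // dvdp_exp2l //; move: ext.
  rewrite /extend0 -E lS => ->.
  by rewrite (leq_trans (size_polyC_leq1 _)).
pose B' := kappa * (A1 + A2 + B) / (killer_but y).[y].
have B'0 : 0 <= B' by rewrite divr_ge0 ?mulr_ge0 ?addr_ge0 // ltW.
pose K := 2 * (normc C + B').
have K0 : 0 <= K by rewrite mulr_ge0 // addr_ge0 ?normc_ge0.
(* For [s = (scale n).+1 * d * A] the three bounds give in turn [s <= 1/4], [2 * s * K <= e / 2] and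
   [d <= eps / 3]; the shifts by 1 keep the denominators positive. *)
pose e1 := Num.min (4 * (A + 1))^-1 (Num.min (e / (4 * (A + 1) * (K + 1))) (eps / 3)).
have Ap : 0 < A + 1 by rewrite ltr_wpDl.
have Kp : 0 < K + 1 by rewrite ltr_wpDl.
have e10 : 0 < e1.
  by rewrite !lt_min invr_gt0 !divr_gt0 ?mulr_gt0.
near=> n.
have nd : model_dims MM n by near: n; exact: near_model_dims.
have n0 := model_dims_gt0 nd.
have Xn : 2 * B' / e <= X n by near: n; apply: near_model; exact: near_scaleX.
have hd : (scale n).+1%:R * n%:R `^ (- th) <= e1.
  by near: n; apply: near_model; exact: near_scale_powR.
have hA1 : normc ((weighted_trace n G0 * n%:R ^+ j)%:C - main_term n G0) <= A1 * X n / n%:R.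
  by near: n; exact: HA1.
have hA2 : normc ((weighted_trace n G2 * n%:R ^+ j)%:C - main_term n G2) <= A2 * X n / n%:R.
  by near: n; exact: HA2.
have x1 := scaleX_ge1 R n; have x0 := scaleX_gt0 R n; have xN := scaleX_le R n0.
have N0 : 0 < n%:R :> R by rewrite ltr0n.
have [D1 D2 Dd] := powR_radius n0 th0 th4.
have D0 : 0 < n%:R `^ th by apply: lt_le_trans D1.
set d := n%:R `^ (- th) in hd Dd *.
have d0 : 0 < d by rewrite Dd invr_gt0.
have d1 : d <= 1 by rewrite Dd invf_le1.
have [hA hK hde] : [/\ (scale n).+1%:R * d * A <= 4^-1,
    2 * ((scale n).+1%:R * d * A) * K <= e / 2 & d <= eps / 3].
  have sd0 : 0 <= (scale n).+1%:R * d by rewrite mulr_ge0 // ltW.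
  move: (hd); rewrite !le_min => /and3P[h1 h2 h3]; split.
  - have h : (scale n).+1%:R * d * (4 * (A + 1)) <= 1.
      by rewrite -ler_pdivlMr ?mulr_gt0 // mul1r.
    by move: ((scale n).+1%:R * d) sd0 h => s s0 h; lra.
  - have h : (scale n).+1%:R * d * (4 * (A + 1) * (K + 1)) <= e.
      by rewrite -ler_pdivlMr // !mulr_gt0.
    have hAK : A * K <= (A + 1) * (K + 1) by nra.
    have := ler_wpM2l sd0 hAK.
    move: ((scale n).+1%:R * d) h => s h; lra.
  - apply: le_trans h3; rewrite ler_peMl // ?(ltW d0) //.
    by rewrite ler1n.
have := HAB n d nd d0 hde d1 (le_trans hA _).
rewrite -/G0 -/G2 => /(_ _)/=; set E := Ein _ _ * _.
set W0 := weighted_trace n G0 * _; set W2 := weighted_trace n G2 * _.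
set w := weight n y; set s := _ * d * A in hA hK *.
move=> hW.
have {hW} hW : `|W0 - w * E| <= 2 * s * (w * E) + d^-1 ^+ 2 * (W2 + B / n%:R).
  by apply: hW; lra.
have E0 : 0 <= E by rewrite mulr_ge0 ?Ein_ge0 // exprn_ge0 // ltW.
have wg : (killer_but y).[y] / X n <= w by apply: weight_ge.
have w0 : 0 < w by apply: lt_le_trans wg; rewrite divr_gt0.
have hW2 : W2 <= A2 * X n / n%:R.
  by apply: le_trans hA2; rewrite main_2 subr0 normc_real ler_norm.
have key : normc (E%:C - C) <= 2 * s * E + B' / X n.
  rewrite -(ler_pM2l w0).
  have -> : w * normc (E%:C - C) = normc ((w * E)%:C - C * w%:C).
    rewrite -{1}(ger0_norm (ltW w0)) -normc_real -Normc.normcM; congr normc.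
    by ring.
  apply: (@le_trans _ _ (`|W0 - w * E| + A1 * X n / n%:R)).
    rewrite (_ : _ - _ = (w * E - W0)%:C + (W0%:C - C * w%:C)); last first.
      by ring.
    apply: (le_trans (ler_normcD _ _)); rewrite normc_real distrC lerD2l.
    by rewrite -main_0.
  rewrite mulrDr (_ : w * (2 * s * E) = 2 * s * (w * E)); last by ring.
  apply: (@le_trans _ _ (2 * s * (w * E) + X n ^+ 4 * (A2 * X n / n%:R + B / n%:R) + A1 * X n / n%:R)).
    rewrite lerD2r (le_trans hW) // lerD2l.
    have BN : 0 <= B / n%:R by rewrite divr_ge0 // ltW.
    have AN : 0 <= A2 * X n / n%:R by rewrite divr_ge0 ?mulr_ge0 // ltW.
    apply: (@le_trans _ _ (d^-1 ^+ 2 * (A2 * X n / n%:R + B / n%:R))).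
      by rewrite ler_wpM2l ?sqr_ge0 // lerD2r.
    by rewrite ler_wpM2r ?addr_ge0 // Dd invrK.
  rewrite -addrA lerD2l.
  apply: (@le_trans _ _ ((A1 + A2 + B) * (X n ^+ 5 / n%:R))).
    have M4 : X n ^+ 4 / n%:R <= X n ^+ 5 / n%:R.
      by rewrite ler_wpM2r ?invr_ge0 ?(ltW N0) // ler_weXn2l.
    have M1 : X n / n%:R <= X n ^+ 5 / n%:R.
      by rewrite ler_wpM2r ?invr_ge0 ?(ltW N0) // -{1}(expr1 (X n)) ler_weXn2l.
    rewrite (_ : X n ^+ 4 * _ = A2 * (X n ^+ 5 / n%:R) + B * (X n ^+ 4 / n%:R)); last by ring.
    have := ler_wpM2l B0 M4; have := ler_wpM2l A10 M1; lra.
  apply: (@le_trans _ _ ((killer_but y).[y] / X n * (B' / X n))); last first.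
    by rewrite ler_wpM2r // divr_ge0 // ltW.
  rewrite (_ : _ / X n * _ = (A1 + A2 + B) * (kappa * X n ^- 2)); last first.
    by rewrite /B'; field; rewrite !gt_eqF.
  rewrite ler_wpM2l ?addr_ge0 //.
  rewrite ler_pdivrMr // mulrAC ler_pdivlMr ?exprn_gt0 // -exprD.
  by rewrite (le_trans _ xN) // ler_weXn2l.
have s0 : 0 <= s by rewrite !mulr_ge0 // ltW.
have BX : B' / X n <= e / 2.
  rewrite ler_pdivrMr //; move: Xn; rewrite ler_pdivrMr // => h.
  by rewrite mulrAC ler_pdivlMr // mulrC [e * _]mulrC.
have BX' : B' / X n <= B' by rewrite ler_pdivrMr // ler_peMr.
(* The error contains [E] itself; since [2 * s <= 1/2], half of [E] is absorbed, which gives an a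
   priori bound. *)
have EK : E <= K.
  have h : E <= normc C + normc (E%:C - C).
    by have := ler_normcB E%:C C; rewrite normc_real ger0_norm.
  have sE : 2 * s * E <= 2^-1 * E by rewrite ler_wpM2r //; lra.
  rewrite /K; move: h key sE BX'; lra.
apply: (le_trans key).
have : 2 * s * E <= 2 * s * K by rewrite ler_wpM2l // mulr_ge0.
move: hK BX; lra.
Unshelve. all: by end_near. Qed.
(** Squares suffice at the large bases because their coefficients are constant by [base_coef_const],
    so nearness to one of them costs only [d ^ 2]. At bases below [L0 + 2 * eps / 3] higher
    exponents may be needed, but real outliers stay [eps / 3] away from those. *)
Lemma Eout_asymp th e : 0 < th -> th <= 4^-1 -> 0 < e ->
  \forall n \near F,
    Eout (model_space MM n) (cdisk (L0 + eps) 0 `|` cthick (n%:R `^ (- th)) [set` S])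
      * n%:R ^+ j <= e.
Proof.
move=> th0 th4 e0.
pose ex (y : R) := if L0 + 2 * eps / 3 <= `|y| then 1%N else total_size.
pose k := Num.min 1 (eps / 3).
have k0 : 0 < k by rewrite lt_min ltr01 divr_gt0.
have k1 : k <= 1 by rewrite ge_min lexx.
have [c' c0 Hc] := prod_dist_ge ex uniq_real_bases k0 k1.
pose G := killer ex.
have main_0 n : main_term n G = 0.
  apply: main_term_eq0 => l lS; apply: killer_dvd => //; rewrite /ex.
  have lR := (S_Re lS).1; case: ifPn => lL.
    by rewrite lR (leq_trans (base_coef_const _ lL)) // -lR.
  by rewrite (leq_trans (size_le_total lS)) // leq_pmull.
have [A A0 HA] := scaled_trace_asymp G.
have [B B0 HB] := weighted_disk_le G.
pose K := kappa * (A + B) / c' ^+ 2.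
have K0 : 0 <= K by rewrite divr_ge0 ?sqr_ge0 // mulr_ge0 // addr_ge0.
near=> n.
have nd : model_dims MM n by near: n; exact: near_model_dims.
have n0 := model_dims_gt0 nd.
have Xn : K / e <= X n by near: n; apply: near_model; exact: near_scaleX.
have hA : normc ((weighted_trace n G * n%:R ^+ j)%:C - main_term n G) <= A * X n / n%:R.
  by near: n; exact: HA.
have x1 := scaleX_ge1 R n; have x0 := scaleX_gt0 R n; have xN := scaleX_le R n0.
have N0 : 0 < n%:R :> R by rewrite ltr0n.
have v0 : 0 < n%:R ^+ j :> R by rewrite exprn_gt0.
have [D1 D2 Dd] := powR_radius n0 th0 th4.
have D0 : 0 < n%:R `^ th by apply: lt_le_trans D1.
set d := n%:R `^ (- th) in Dd *.
have d0 : 0 < d by rewrite Dd invr_gt0.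
have d1 : d <= 1 by rewrite Dd invf_le1.
(* The reciprocal of the lower bound [(c' d) ^ 2 / X] for the test polynomial at an outlier. It is
   [O(X ^ 5)] and the scaled trace is [O(X / n)], in all [O(X ^ 6 / n)]. *)
pose Q := X n * (d^-1 ^+ 2) / c' ^+ 2.
have Q0 : 0 <= Q by rewrite divr_ge0 ?sqr_ge0 // mulr_ge0 ?sqr_ge0 // ltW.
pose Out := ~` (cdisk (L0 + eps) 0 `|` cthick d [set` S]).
pose sl := B * n%:R ^- j.+2.
have sl0 : 0 <= sl by rewrite mulr_ge0 // invr_ge0 exprn_ge0 // ler0n.
have up : Eout (model_space MM n) (cdisk (L0 + eps) 0 `|` cthick d [set` S]) <=
    Q * weighted_trace n G + n%:R * (Q * sl).
  rewrite /Eout EinE -/Out weighted_traceE -linear_statZ.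
  rewrite -(@linear_stat_cst R n (model_space MM n)) -linear_statD.
  apply: ler_model_stat => // [x xL|z zd]; last first.
    have -> : z \in Out = false.
      apply/negbTE/negP; rewrite inE /Out /= => /not_orP[] + _; apply.
      move: zd; rewrite /cdisk /= => /le_trans; apply.
      by rewrite lerDl ltW.
    have := HB n n0 z zd; rewrite ler_norml => /andP[h _].
    by rewrite -mulrDr mulr_ge0 // -lerBlDr sub0r.
  rewrite Re_horner_real -mulrDr.
  have W0 : 0 <= (weighted n G).[x] by apply: weighted_ge0 xL (killer_ge0 _ x).
  case: (boolP (x%:C \in Out)) => xO; last by rewrite mulr_ge0 // addr_ge0.
  apply: (@le_trans _ _ (Q * (weighted n G).[x])); last by rewrite ler_wpM2l // lerDl.
  move: xO; rewrite inE /Out /= => /not_orP[xB xT].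
  have xL0 : L0 + eps < `|x|.
    rewrite ltNge; apply/negP => h; apply: xB.
    by rewrite /cdisk /mkset subr0 normc_real.
  have xd y : y \in real_bases -> d <= `|x - y|.
    rewrite mem_real_bases => yS; apply/ltW; rewrite ltNge; apply/negP => h.
    apply: xT; exists y%:C => //.
    by have := cdisk_real d y x; rewrite h => /set_mem.
  have xk y : y \in real_bases -> ex y != 1%N -> k <= `|x - y|.
    move=> _; rewrite /ex; case: leP => // yL _; rewrite ge_min; apply/orP; right.
    have := ler_normB x y; have := lerB_dist x y.
    by move: xL0 yL eps_gt0; lra.
  have h := Hc x d (ltW d0) d1 xd xk.
  have hG : (c' * d) ^+ 2 <= G.[x].
    rewrite hornerE_killer prodrXl lerXn2r ?nnegrE //.
      by rewrite mulr_ge0 // ltW.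
    by rewrite prodr_ge0 // => y _; rewrite exprn_ge0.
  have hf : (X n)^-1 <= f.[x] ^+ scale n.
    by apply: step_pow_ge xL; move: xL0 eps_gt0; lra.
  have hW : (X n)^-1 * (c' * d) ^+ 2 <= (weighted n G).[x].
    by rewrite hornerM horner_exp ler_pM ?invr_ge0 ?sqr_ge0 // ltW.
  apply: le_trans (ler_wpM2l Q0 hW).
  by rewrite /Q le_eqVlt; apply/orP; left; apply/eqP; field; rewrite !gt_eqF.
have hT : weighted_trace n G * n%:R ^+ j <= A * X n / n%:R.
  by apply: le_trans hA; rewrite main_0 subr0 normc_real ler_norm.
apply: (le_trans (ler_wpM2r (ltW v0) up)).
have -> : (Q * weighted_trace n G + n%:R * (Q * sl)) * n%:R ^+ j =
    Q * (weighted_trace n G * n%:R ^+ j + B / n%:R).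
  by rewrite -(scaled_slack B n0) -/sl; ring.
apply: (@le_trans _ _ (Q * (A * X n / n%:R + B / n%:R))).
  by rewrite ler_wpM2l // lerD2r.
apply: (@le_trans _ _ (X n ^+ 5 / c' ^+ 2 * ((A + B) * X n / n%:R))).
  apply: ler_pM => //.
  - by rewrite addr_ge0 // divr_ge0 ?mulr_ge0 // ltW.
  - by rewrite /Q Dd invrK ler_wpM2r ?invr_ge0 ?sqr_ge0 // exprS ler_wpM2l // ltW.
  - rewrite -mulrDl ler_wpM2r ?invr_ge0 ?(ltW N0) // mulrDl lerD2l.
    by rewrite ler_peMr.
apply: (@le_trans _ _ (K / X n)).
  rewrite [leLHS](_ : _ = (A + B) / c' ^+ 2 * (X n ^+ 6 / n%:R)); last first.
    by field; rewrite !gt_eqF.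
  rewrite (_ : K / X n = (A + B) / c' ^+ 2 * (kappa / X n)); last first.
    by rewrite /K; field; rewrite !gt_eqF.
  rewrite ler_wpM2l ?divr_ge0 ?addr_ge0 ?sqr_ge0 //.
  rewrite ler_pdivrMr // mulrAC ler_pdivlMr // -exprSr.
  by rewrite (le_trans _ xN) // ler_weXn2l.
by rewrite ler_pdivrMr // mulrC -ler_pdivrMr.
Unshelve. all: by end_near. Qed.

(** * Limits, bounds and Landau notation *)

Lemma model_exists (P : nat -> Prop) : (\forall n \near F, P n) -> exists n, P n.
Proof.
move=> PF; apply: contrapT => nP; apply: near_model_false.
by apply: filterS PF => n Pn; apply: nP; exists n.
Qed.

Lemma limit_real_ge0 (C : R[i]) (h : nat -> R) : (forall n, 0 <= h n) ->
  (forall e, 0 < e -> \forall n \near F, normc ((h n)%:C - C) <= e) ->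
  exists2 a : R, 0 <= a & C = a%:C.
Proof.
case: C => a b0 h0 hC.
have hab e : 0 < e -> - e <= a /\ `|b0| <= e.
  move=> e0; have [n hn] := model_exists (hC e e0).
  split.
    have := le_trans (normc_ge_absRe _) hn; rewrite /= ler_norml => /andP[_].
    by have := h0 n; lra.
  apply: le_trans hn; rewrite /= -sqrtr_sqr ler_wsqrtr //.
  by rewrite sub0r sqrrN lerDr sqr_ge0.
have bz : b0 = 0.
  apply/eqP; rewrite -normr_le0; apply/ler_addgt0Pr => e e0.
  by rewrite add0r; case: (hab e e0).
exists a; last by rewrite bz.
by rewrite -oppr_le0; apply/ler_addgt0Pr => e e0; rewrite add0r lerNl; case: (hab e e0).
Qed.

Lemma base_coefE y : L0 + 2 * eps / 3 <= `|y| ->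
  exists C : R[i], extend0 S p y%:C = C%:P.
Proof.
move=> yL; rewrite /extend0; case: ifPn => [yS|_]; last by exists 0.
by exists (p y%:C)`_0; apply: size1_polyC; apply: base_coef_const.
Qed.

Lemma Ein_ball_bounded y th : L0 + 2 * eps / 3 <= `|y| -> `|y| <= L1 ->
  0 < th -> th <= 4^-1 -> exists K : R, \forall n \near F,
    Ein (model_space MM n) (cdisk (n%:R `^ (- th)) y%:C) * n%:R ^+ j <= K.
Proof.
move=> yL yL1 th0 th4; have [C ext] := base_coefE yL.
exists (normc C + 1).
have := Ein_ball_asymp yL yL1 ext th0 th4 ltr01; apply: filterS => n.
set E := Ein _ _ * _ => h.
have := ler_normcB E%:C C; rewrite normc_real => h'.
by apply: (le_trans (ler_norm E)); apply: (le_trans h'); rewrite lerD2l.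
Qed.

(** A point outside the disk of radius [L0 + eps] but within [eps / 3] of a base forces that base to
    modulus at least [L0 + 2 * eps / 3], where ball counts are controlled. *)
Lemma Eout_le_Ein n d : 0 < d -> d <= eps / 3 ->
  Eout (model_space MM n) (cdisk (L0 + eps) 0) <=
  Eout (model_space MM n) (cdisk (L0 + eps) 0 `|` cthick d [set` S]) +
  \sum_(y <- real_bases | L0 + 2 * eps / 3 <= `|y|) Ein (model_space MM n) (cdisk d y%:C).
Proof.
move=> d0 de; rewrite /Eout !EinE; under eq_bigr => y _ do rewrite EinE.
rewrite -linear_stat_sum -linear_statD; apply: ler_linear_stat => M z _ _.
have s0 (P : pred R) : 0 <= \sum_(y <- real_bases | P y) ((z \in cdisk d y%:C)%:R : R).
  by apply: sumr_ge0 => y _; rewrite ler0n.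
case: (boolP (z \in _)) => [zB|_]; last by rewrite addr_ge0 ?ler0n.
case: (boolP (z \in _)) => [_|zO]; first by rewrite lerDl.
move: zB zO => /set_mem zB /negP; rewrite inE => /contrapT[//|[l lS zl]].
have [lR lL1] := S_Re lS.
have lL : L0 + 2 * eps / 3 <= `|complex.Re l|.
  rewrite leNgt; apply/negP => h; apply: zB; rewrite /cdisk /mkset subr0.
  have := ler_normcB z l; move: zl; rewrite /cdisk /mkset.
  rewrite {2}lR normc_real; move: eps_gt0; lra.
have lm : complex.Re l \in real_bases by rewrite mem_real_bases -lR.
rewrite add0r big_mkcond (bigD1_seq (complex.Re l)) ?uniq_real_bases //= lL -lR.
by rewrite (mem_set zl) lerDl -big_mkcondr; apply: sumr_ge0 => y _; rewrite ler0n.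
Qed.

Lemma Eout_bounded : exists K : R, \forall n \near F,
  Eout (model_space MM n) (cdisk (L0 + eps) 0) * n%:R ^+ j <= K.
Proof.
have th0 : 0 < 4^-1 :> R by rewrite invr_gt0.
pose d n : R := n%:R `^ (- 4^-1).
have hs (s : seq R) : (forall y, y \in s -> `|y| <= L1) -> exists K : R, \forall n \near F,
    \sum_(y <- s | L0 + 2 * eps / 3 <= `|y|)
      Ein (model_space MM n) (cdisk (d n) y%:C) * n%:R ^+ j <= K.
  elim: s => [|y s IH] sL.
    by exists 0; apply: near_model; near=> n; rewrite big_nil.
  have [K HK] := IH (fun y' ys => sL y' (mem_behead (s := y :: s) ys)).
  have [yL|yL] := boolP (L0 + 2 * eps / 3 <= `|y|); last first.
    by exists K; apply: filterS HK => n; rewrite big_cons (negPf yL).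
  have [K' HK'] := Ein_ball_bounded yL (sL y (mem_head _ _)) th0 (lexx _).
  exists (K' + K); apply: filterS2 HK HK' => n h h'.
  by rewrite big_cons yL lerD.
have [|K HK] := hs real_bases.
  by move=> y; rewrite mem_real_bases => /S_Re[].
have HO := Eout_asymp th0 (lexx _) ltr01.
exists (1 + K); near=> n.
have nd : model_dims MM n by near: n; exact: near_model_dims.
have n0 := model_dims_gt0 nd.
have v0 : 0 <= n%:R ^+ j :> R by rewrite exprn_ge0.
have d0 : 0 < d n by rewrite powR_gt0 // ltr0n.
have de : d n <= eps / 3.
  apply: (@le_trans _ _ ((scale n).+1%:R * d n)); first by rewrite ler_peMl ?ler1n // ltW.
  by near: n; apply: near_model; apply: near_scale_powR => //; rewrite divr_gt0.
apply: (le_trans (ler_wpM2r v0 (Eout_le_Ein n d0 de))).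
rewrite mulrDl; apply: lerD; first by near: n; exact: HO.
by rewrite mulr_suml; near: n; exact: HK.
Unshelve. all: by end_near. Qed.

Lemma Ein_ball_littleo y (a : R) th :
  L0 + 2 * eps / 3 <= `|y| -> `|y| <= L1 -> extend0 S p y%:C = (a%:C)%:P ->
  0 < th -> th <= 4^-1 ->
  (fun n : nat => Ein (model_space MM n) (cdisk (n%:R `^ (- th)) y%:C))
  = (fun n : nat => a * n%:R ^- j) +o_F (fun n : nat => (n%:R : R) ^- j).
Proof.
move=> yL yL1 ext th0 th4; apply/eqaddoP => e e0.
have := Ein_ball_asymp yL yL1 ext th0 th4 e0.
have := near_model_dims; apply: filterS2 => n /model_dims_gt0 n0.
have v0 : 0 < n%:R ^+ j :> R by rewrite exprn_gt0 // ltr0n.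
rewrite -rmorphB normc_real => h /=.
rewrite [X in _ <= e * X]ger0_norm ?invr_ge0 ?(ltW v0) // ler_pdivlMr //.
apply: le_trans h; rewrite -[X in _ * X]ger0_norm ?(ltW v0) // -normrM.
rewrite le_eqVlt; apply/orP; left; apply/eqP; congr `|_|.
by rewrite !fctE mulrBl mulfVK // gt_eqF.
Qed.

(** The coefficient is a limit of nonnegative scaled counts. Any admissible radius may be used,
    since the coefficient does not depend on it; hence a single [a] serves all exponents. *)
Lemma base_coef_real y : L0 + 2 * eps / 3 <= `|y| -> `|y| <= L1 ->
  exists2 a : R, 0 <= a & extend0 S p y%:C = (a%:C)%:P.
Proof.
move=> yL yL1; have [C ext] := base_coefE yL.
have th0 : 0 < 4^-1 :> R by rewrite invr_gt0.
have [|a a0 Ca] := limit_real_ge0 _ (fun e => @Ein_ball_asymp y C _ e yL yL1 ext th0 (lexx _)).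
  by move=> n; rewrite mulr_ge0 ?Ein_ge0 // exprn_ge0.
by exists a => //; rewrite ext Ca.
Qed.

Lemma Eout_bigO :
  (fun n : nat => Eout (model_space MM n) (cdisk (L0 + eps) 0))
    =O_F (fun n : nat => (n%:R : R) ^- j).
Proof.
have [K HK] := Eout_bounded; apply/eqO_exP; exists (`|K| + 1); first by rewrite ltr_wpDl.
have := near_model_dims; apply: filterS2 HK => n h /model_dims_gt0 n0.
have v0 : 0 < n%:R ^+ j :> R by rewrite exprn_gt0 // ltr0n.
rewrite ger0_norm ?Ein_ge0 // [X in _ * X]ger0_norm ?invr_ge0 ?(ltW v0) // ler_pdivlMr //.
by apply: (le_trans h); rewrite (le_trans (ler_norm K)) // lerDl.
Qed.

Lemma Eout_littleo th : 0 < th -> th <= 4^-1 ->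
  (fun n : nat => Eout (model_space MM n)
     (cdisk (L0 + eps) 0 `|` cthick (n%:R `^ (- th)) [set` S]))
  =o_F (fun n : nat => (n%:R : R) ^- j).
Proof.
move=> th0 th4; apply/eqoP => e e0.
have := Eout_asymp th0 th4 e0.
have := near_model_dims; apply: filterS2 => n /model_dims_gt0 n0 h.
have v0 : 0 < n%:R ^+ j :> R by rewrite exprn_gt0 // ltr0n.
by rewrite !ger0_norm ?invr_ge0 ?(ltW v0) ?Ein_ge0 // ler_pdivlMr.
Qed.

End WeightedTrace.

Lemma large_part0_growth (R : realType) (r : R) Q S p :
  large_part r Q S p -> [set` S] = set0 -> of_growth r Q.
Proof.
move=> [_ _ gr] S0; apply: of_growth_pos gr => k _.
by rewrite /exppoly big1_seq ?subr0 // => l /andP[_ lS]; have : [set` S] l by []; rewrite S0.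
Qed.

Theorem lemma2p6 (R : realType) (L0 L1 eps : R) (j : nat)
    (L0_gt0 : 0 < L0) (L0_lt_L1 : L0 < L1) (eps_gt0 : 0 < eps)
    (L0_eps_le : L0 + eps <= L1) :
  exists (r1 : nat) (theta1 : R),
    [/\ (j.+1 <= r1)%N, 0 < theta1 &
    forall (MM : matrix_model R) (r : nat) (c : nat -> nat -> R[i]),
      bounded_model L0 L1 MM ->
      (r1 <= r)%N ->
      has_expansion L0 L1 MM r c ->
      let F := model_oo MM in
      let L := larger_bases_upto L0 c in
      L j = set0 ->
      [/\ (fun n : nat => Eout (model_space MM n) (cdisk (L0 + eps) 0))
            =O_F (fun n : nat => (n%:R : R) ^- j),
          forall theta : R, 0 < theta -> theta <= theta1 ->
            (fun n : nat => Eout (model_space MM n)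
               (cdisk (L0 + eps) 0 `|` cthick (n%:R `^ (- theta)) (L j.+1)))
            =o_F (fun n : nat => (n%:R : R) ^- j)
        & forall l : R[i], L j.+1 l ->
            L0 + 2 * eps / 3 <= Normc.normc l ->
            exists Cl : R,
              [/\ 0 <= Cl,
                  forall theta : R, 0 < theta -> theta <= theta1 ->
                    (fun n : nat => Ein (model_space MM n) (cdisk (n%:R `^ (- theta)) l))
                    = (fun n : nat => Cl * n%:R ^- j)
                    +o_F (fun n : nat => (n%:R : R) ^- j)
                & forall q : R[i] -> {poly R[i]},
                    polyexp_part L0 (c j)
                      (fun k => \sum_(l' \in L j.+1) (q l').[k%:R] * l' ^+ k) ->
                    q l = (Cl%:C)%:P]]].
Proof.
have rt : L0 + eps / 3 < L0 + 2 * eps / 3 by lra.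
have [f [f0 fabs fitv fstep]] : exists f : {poly R}, [/\ f`_0 = 0,
    abs_sum f (L0 + eps / 3) <= 2 ^- (8 * j.+2),
    forall x, `|x| <= L1 -> 0 <= f.[x] <= 1
  & forall x, L0 + 2 * eps / 3 <= `|x| -> `|x| <= L1 -> 2^-1 <= f.[x]].
  apply: step_poly; [lra | exact: rt | lra | by rewrite invr_gt0 exprn_gt0 |].
  by rewrite invf_le1 ?exprn_gt0 // exprn_ege1 // ler1n.
pose b := Num.bound (abs_sum f (2 * L1)).
have fb : abs_sum f (2 * L1) <= 2 ^+ b.
  have a0 : 0 <= abs_sum f (2 * L1) by rewrite abs_sum_ge0 // mulr_ge0 // ltW // (lt_trans L0_gt0).
  apply: (le_trans (ltW (archi_boundP a0))).
  by rewrite -natrX ler_nat ltnW // ltn_expl.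
(* [f], and with it [b], was built from [L0], [L1], [eps] and [j] alone, before any model is
   given. *)
exists (j.+1 + b)%N, 4^-1; split; [exact: leq_addr | by rewrite invr_gt0 |].
move=> MM r c Mb rge Mexp F L Lj0.
have ir i : (i <= j)%N -> (i < r)%N.
  by move=> ij; rewrite (leq_trans _ rge) // addSn ltnS (leq_trans ij) // leq_addr.
have [_ _ Hc] := Mexp.
have cgrowth i : (i < j)%N -> of_growth L0 (c i).
  move=> ij; have [/(large_part_exists L0_gt0)[S [p HS]] _] := Hc i (ir i (ltnW ij)).
  apply: (large_part0_growth HS); rewrite -(larger_bases_large L0_gt0 HS).
  by rewrite -subset0 -Lj0 => l lc; exists i.
have [/(large_part_exists L0_gt0)[S [p HS]] Sreal] := Hc j (ir j (leqnn j)).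
have SE := larger_bases_large L0_gt0 HS; rewrite SE in Sreal.
have LE : L j.+1 = [set` S].
  apply/seteqP; split=> [l [m /= mj lm]|l lS]; last by exists j => //=; rewrite SE.
  move: mj lm; rewrite ltnS leq_eqVlt => /predU1P[->|mj lm]; first by rewrite SE.
  suff : L j l by rewrite Lj0.
  by exists m.
have O := Eout_bigO L0_gt0 eps_gt0 L0_eps_le f0 fabs fitv fstep fb rge Mb
  Mexp cgrowth HS Sreal.
have o := Eout_littleo L0_gt0 eps_gt0 L0_eps_le f0 fabs fitv fstep fb rge Mb
  Mexp cgrowth HS Sreal.
have coef := base_coef_real L0_gt0 eps_gt0 L0_eps_le f0 fabs fitv fstep fb rge Mb
  Mexp cgrowth HS Sreal.
have ball := Ein_ball_littleo L0_gt0 eps_gt0 L0_eps_le f0 fabs fitv fstep fb rge Mb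
  Mexp cgrowth HS Sreal.
rewrite LE; split=> // l lS lL.
have [y yI yl] := Sreal l lS; rewrite /= in_itv /= -ler_norml in yI.
rewrite -yl normc_real in lL *.
have [a a0 ext] := coef y lL yI.
exists a; split=> //; first by move=> th th0 th1; apply: ball.
have yS : y%:C \in S by rewrite yl.
move=> q qp; have := ext; rewrite /extend0 yS => <-.
apply: polyexp_part_coef HS _ yS qp => //.
by rewrite normc_real; apply: lt_le_trans lL; lra.
Qed.
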